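(* Let $R=\mathbb{C}[x_0,\ldots,x_n]$ and let $I=(F_1,\ldots,F_r)\subset R$ be an artinian ideal generated by homogeneous forms of degree $d$. Let $K$ be the syzygy bundle on $\mathbb{P}^n$ defined by the exact sequence $$0\longrightarrow K\longrightarrow \mathcal{O}_{\mathbb{P}^n}^{r}\xrightarrow{\ \Phi_I\ }\mathcal{O}_{\mathbb{P}^n}(d)\longrightarrow 0,\qquad \Phi_I(a_1,\ldots,a_r)=a_1F_1+\cdots+a_rF_r .$$ Let $i$ be a non-negative integer such that $\mathrm{h}^0(K(i))=0$ and let $k$ be an integer with $k\ge 1$. Then $I$ fails the SLP at the range $k$ in degree $d+i-k$ if and only if the induced homomorphism on sections $$\mathrm{H}^0(\Phi_{I,L^k}):\ \mathrm{H}^0(\mathcal{O}_{L^k}(i))^{r}\longrightarrow \mathrm{H}^0(\mathcal{O}_{L^k}(i+d))$$ does not have maximal rank for a general linear form $L$.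
   Context: The ground field is $\mathbb{C}$. For an artinian homogeneous ideal $I\subset R$ put $A=R/I=\bigoplus_j A_j$. A linear map has maximal rank if it is injective or surjective. For $k\ge1$, $I$ fails the SLP (Strong Lefschetz Property) at the range $k$ in degree $j$ if for every linear form $L$ the multiplication map $\times L^k:A_j\to A_{j+k}$ does not have maximal rank. For a nonzero linear form $L$, $\mathcal{O}_{L^k}$ denotes the structure sheaf of the hypersurface $\{L^k=0\}\subset\mathbb{P}^n$, $\mathcal{O}_{L^k}(t)=\mathcal{O}_{L^k}\otimes\mathcal{O}_{\mathbb{P}^n}(t)$, and $\mathrm{H}^0(\Phi_{I,L^k})$ is the map $(a_1,\ldots,a_r)\mapsto a_1F_1+\cdots+a_rF_r$ on global sections obtained by restricting $\Phi_I(i)$ to $\{L^k=0\}$. *)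

(* Defs.v *)
From HB Require Import structures.
From mathcomp Require Import all_boot all_order all_algebra.
From mathcomp Require Import reals complex.
From mathcomp Require Import mpoly.

Set Implicit Arguments.
Unset Strict Implicit.
Unset Printing Implicit Defensive.

Import Order.TTheory GRing.Theory Num.Theory.
Local Open Scope ring_scope.

(** ** Subquotients and maximal rank

   The spaces below (graded pieces of a quotient ring, global sections of a
   sheaf) are presented as subquotients: a carrier of representatives, the
   representatives that are allowed, and when two of them are equal. *)

Record subquot := Subquot {
  carrier : Type;
  mem_sq : carrier -> Prop;
  eq_sq : carrier -> carrier -> Prop }.

Definition sq_injective (X Y : subquot) (phi : carrier X -> carrier Y) : Prop :=
  forall x x' : carrier X, mem_sq x -> mem_sq x' ->
    eq_sq (phi x) (phi x') -> eq_sq x x'.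

Definition sq_surjective (X Y : subquot) (phi : carrier X -> carrier Y) : Prop :=
  forall y : carrier Y, mem_sq y ->
    exists x : carrier X, mem_sq x /\ eq_sq (phi x) y.

Definition maximal_rank (X Y : subquot) (phi : carrier X -> carrier Y) : Prop :=
  sq_injective phi \/ sq_surjective phi.

Definition sq_power (r : nat) (X : subquot) : subquot :=
  @Subquot ('I_r -> carrier X)
           (fun a => forall j, mem_sq (a j))
           (fun a b => forall j, eq_sq (a j) (b j)).

(** ** Ideals, artinian quotients, graded pieces *)

Definition is_ideal (A : pzRingType) (J : A -> Prop) : Prop :=
  [/\ J 0, forall f g, J f -> J g -> J (f + g) & forall h f, J f -> J (h * f)].

Definition ideal_gen (A : pzRingType) (r : nat) (F : 'I_r -> A) : A -> Prop :=
  fun f => exists a : 'I_r -> A, f = \sum_(j < r) a j * F j.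

Definition zero_ideal (A : pzRingType) : A -> Prop := fun f => f = 0.

Definition principal_ideal (A : pzRingType) (g : A) : A -> Prop :=
  fun f => exists h : A, f = h * g.

(* The quotient by [I] is an artinian ring: the descending chain condition for
   ideals of the quotient, i.e. for ideals containing [I]. *)
Definition artinian_ideal (A : pzRingType) (I : A -> Prop) : Prop :=
  forall J : nat -> A -> Prop,
    (forall m, is_ideal (J m)) ->
    (forall m f, I f -> J m f) ->
    (forall m f, J m.+1 f -> J m f) ->
    exists N, forall m, (N <= m)%N -> forall f, J m f <-> J N f.

(* Degrees range over the integers, so that degrees such as [d + i - k] are not
   truncated; the pieces of negative degree are zero. *)
Definition in_degree (C : fieldType) (N : nat) (t : int) (f : {mpoly C[N]}) :
    bool :=
  match t with
  | Posz m => f \is m.-homog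
  | Negz _ => f == 0
  end.

Definition graded_piece (C : fieldType) (N : nat)
    (I : {mpoly C[N]} -> Prop) (t : int) : subquot :=
  @Subquot {mpoly C[N]} (in_degree t) (fun f g => I (f - g)).

Definition mul_power (C : fieldType) (N : nat) (I : {mpoly C[N]} -> Prop)
    (L : {mpoly C[N]}) (k : nat) (j : int) :
    carrier (graded_piece I j) -> carrier (graded_piece I (j + k%:Z)) :=
  fun f => L ^+ k * f.

Definition fails_SLP (C : fieldType) (N : nat) (I : {mpoly C[N]} -> Prop)
    (k : nat) (j : int) : Prop :=
  forall L : {mpoly C[N]}, L \is 1.-homog ->
    ~ maximal_rank (mul_power (I := I) L k (j := j)).

(** ** Global sections on projective space

   P^n is glued from the charts U_j = {x_j <> 0}, 0 <= j <= n.  For a homogeneous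
   ideal J of S = C[x_0, ..., x_n] with closed subscheme X = V(J), the sections of
   O_X(t) over U_j are the degree t part of the localization (S/J)_{x_j}, and
   over U_j \cap U_l the degree t part of (S/J)_{x_j x_l}.  A global section is
   a family of sections over the charts that agree on the overlaps.  The case
   J = 0 gives O(t), and J = (L^k) gives the sheaf O_{L^k}(t).  (The sections
   are in general not identified with the degree t part of S/J: for n = 1 they
   are not.) *)

(* Equality of f/u and g/v in (S/J)_h, for u and v dividing powers of h. *)
Definition eq_frac (A : comPzRingType) (J : A -> Prop) (h f u g v : A) : Prop :=
  exists e : nat, J (h ^+ e * (v * f - u * g)).

(* [(f, m)] stands for the fraction f / x_j ^ m over the chart U_j. *)
Definition fraction (C : fieldType) (N : nat) : Type := {mpoly C[N]} * nat.

Definition H0 (C : fieldType) (N : nat) (J : {mpoly C[N]} -> Prop) (t : int) :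
    subquot :=
  @Subquot ('I_N -> fraction C N)
    (fun s =>
       (forall j, in_degree (t + (s j).2%:Z) (s j).1) /\
       (forall j l, eq_frac J ('X_j * 'X_l)
                      (s j).1 ('X_j ^+ (s j).2) (s l).1 ('X_l ^+ (s l).2)))
    (fun s s' =>
       forall j, eq_frac J 'X_j
                   (s j).1 ('X_j ^+ (s j).2) (s' j).1 ('X_j ^+ (s' j).2)).

Definition zero_frac (C : fieldType) (N : nat) : fraction C N := (0, 0%N).

Definition add_frac (C : fieldType) (N : nat) (j : 'I_N) (a b : fraction C N) :
    fraction C N :=
  ('X_j ^+ b.2 * a.1 + 'X_j ^+ a.2 * b.1, (a.2 + b.2)%N).

Definition scale_frac (C : fieldType) (N : nat) (G : {mpoly C[N]})
    (a : fraction C N) : fraction C N :=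
  (G * a.1, a.2).

(* (a_1, ..., a_r) |-> a_1 F_1 + ... + a_r F_r, for F_1, ..., F_r of degree d *)
Definition H0_Phi (C : fieldType) (N r d : nat) (F : 'I_r -> {mpoly C[N]})
    (J : {mpoly C[N]} -> Prop) (t : int) :
    carrier (sq_power r (H0 J t)) -> carrier (H0 J (t + d%:Z)) :=
  fun a j =>
    \big[add_frac j / zero_frac C N]_(s < r) scale_frac (F s) (a s j).

(* Sections of the kernel sheaf K(t) are the sections of O(t)^r that Phi_I(t)
   maps to 0. *)
Definition H0_K (C : fieldType) (N r d : nat) (F : 'I_r -> {mpoly C[N]})
    (t : int) : subquot :=
  let O := @zero_ideal {mpoly C[N]} in
  @Subquot (carrier (sq_power r (H0 O t)))
    (fun a => mem_sq a /\
       eq_sq (H0_Phi d F a) ((fun=> zero_frac C N) : carrier (H0 O (t + d%:Z))))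
    (@eq_sq (sq_power r (H0 O t))).

Definition h0_K_eq0 (C : fieldType) (N r d : nat) (F : 'I_r -> {mpoly C[N]})
    (t : int) : Prop :=
  forall a : carrier (H0_K d F t), mem_sq a ->
    eq_sq a ((fun _ _ => zero_frac C N) : carrier (H0_K d F t)).

(** ** General linear forms *)

Definition zariski_closed (C : fieldType) (N : nat) (Z : ('I_N -> C) -> Prop) :
    Prop :=
  exists E : {mpoly C[N]} -> Prop,
    forall v, Z v <-> (forall p, E p -> p.@[v] = 0).

Definition zariski_open (C : fieldType) (N : nat) (U : ('I_N -> C) -> Prop) :
    Prop :=
  zariski_closed (fun v => ~ U v).

(* [P] holds for every nonzero linear form in some nonempty Zariski open subset
   of the affine space of linear forms, with their coefficients as coordinates. *)
Definition for_general_linear_form (C : fieldType) (N : nat)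
    (P : {mpoly C[N]} -> Prop) : Prop :=
  exists U : ('I_N -> C) -> Prop,
    [/\ zariski_open U, exists v, U v &
        forall L : {mpoly C[N]}, L \is 1.-homog -> L != 0 ->
          U (fun j => L@_U_(j)) -> P L].

(* Main.v *)
(** In at least three variables two coordinates form a regular sequence modulo
    [L^k], so [H^0(O_{L^k}(t))] is the degree [t] part of [S/(L^k)].  A relation
    [sum_s a_s F_s = L^k f] with [a] of degree [i] then says both that [f] is
    killed by [L^k] in [S/I] and that [a] is killed by [Phi_I] modulo [L^k]; since
    there are no syzygies of degree [i], the two maps are injective together, and
    they have the same cokernel.  Maximal rank is an open condition on [L], so
    "fails for every L" and "fails for general L" agree.

    In one or two variables the sections are not [S/(L^k)], but both sides of the
    equivalence are false.  In two variables a form [F_s] not vanishing at the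
    point [L = 0] makes the map on sections surjective, while [L^k] has maximal
    rank for some [L] because the jets of order [k] of a space of univariate
    polynomials have maximal rank at a general point (the Wronskian argument,
    where characteristic 0 enters). *)

Require Import Defs.
From HB Require Import structures.
From mathcomp Require Import all_boot all_order all_algebra.
From mathcomp Require Import reals complex.
From mathcomp Require Import boolp.
From mathcomp Require Import ring.
From mathcomp Require Import mpoly.

Set Implicit Arguments.
Unset Strict Implicit.
Unset Printing Implicit Defensive.

Import Order.TTheory GRing.Theory Num.Theory.
Import VectorInternalTheory.
Local Open Scope ring_scope.
Local Open Scope complex_scope.

(** * Homogeneous ideals and ideals of linear forms *)

(** Multiplication by [G] shifts every homogeneous component of [a] by [d], so only the one of
    degree [e] reaches degree [e + d]. *)
Lemma pihomogMr (C : fieldType) (N d e : nat) (a G : {mpoly C[N]}) :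
  G \is d.-homog -> pihomog mdeg (e + d) (a * G) = pihomog mdeg e a * G.
Proof.
move=> hG; have hM b : pihomog mdeg b a * G \is (b + d).-homog.
  exact: dhomogM (pihomogP _ _ _) hG.
rewrite {1}(pihomog_partitionE (leqnn (msize a))) mulr_suml raddf_sum /=.
have [lt_e|le_e] := ltnP e (msize a).
  rewrite (bigD1 (Ordinal lt_e)) //= (pihomog_dE (hM e)) big1 ?addr0 // => b nb.
  apply: pihomog_ne0 (hM b); rewrite eqn_add2r; apply: contraNneq nb => eb.
  exact/eqP/val_inj.
rewrite [pihomog mdeg e a]big1_seq ?mul0r; last first.
  move=> m /andP[/eqP em /msize_mdeg_lt].
  by rewrite em ltnNge le_e.
rewrite big1 // => b _; apply: pihomog_ne0 (hM b); rewrite eqn_add2r neq_ltn.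
by rewrite (leq_trans (ltn_ord b) le_e).
Qed.

Lemma pihomogMr_small (C : fieldType) (N d e : nat) (a G : {mpoly C[N]}) :
  G \is d.-homog -> (e < d)%N -> pihomog mdeg e (a * G) = 0.
Proof.
move=> hG lt_ed; rewrite {1}(pihomog_partitionE (leqnn (msize a))) mulr_suml.
rewrite raddf_sum /= big1 // => b _.
apply: pihomog_ne0 (dhomogM (pihomogP _ _ _) hG).
by rewrite neq_ltn orbC (leq_trans lt_ed) ?leq_addl.
Qed.

(** Cutting each coefficient down to its component of degree [e] does not change the combination, as
    [f] lives in degree [e + d]. Membership in the ideal thus becomes linear algebra in one
    degree. *)
Lemma ideal_gen_homog (C : fieldType) (N r d e : nat)
    (F : 'I_r -> {mpoly C[N]}) (f : {mpoly C[N]}) :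
  (forall s, F s \is d.-homog) -> f \is (e + d).-homog -> ideal_gen F f ->
  exists a : 'I_r -> {mpoly C[N]},
    (forall s, a s \is e.-homog) /\ f = \sum_(s < r) a s * F s.
Proof.
move=> hF hf [a fE]; exists (fun s => pihomog mdeg e (a s)); split.
  by move=> s; exact: pihomogP.
rewrite -(pihomog_dE hf) fE raddf_sum; apply: eq_bigr => s _ /=.
by rewrite pihomogMr.
Qed.

Lemma ideal_gen_homog_small (C : fieldType) (N r d e : nat)
    (F : 'I_r -> {mpoly C[N]}) (f : {mpoly C[N]}) :
  (forall s, F s \is d.-homog) -> f \is e.-homog -> (e < d)%N ->
  ideal_gen F f -> f = 0.
Proof.
move=> hF hf lt_ed [a fE]; rewrite -(pihomog_dE hf) fE raddf_sum big1 // => s _.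
exact: pihomogMr_small.
Qed.

Lemma ideal_gen_ideal (A : comPzRingType) (r : nat) (F : 'I_r -> A) :
  is_ideal (ideal_gen F).
Proof.
split; first by exists (fun=> 0); rewrite big1 // => s _; rewrite mul0r.
  move=> f g [a ->] [b ->]; exists (fun s => a s + b s); rewrite -big_split /=.
  by apply: eq_bigr => s _; rewrite mulrDl.
move=> h f [a ->]; exists (fun s => h * a s); rewrite mulr_sumr.
by apply: eq_bigr => s _; rewrite mulrA.
Qed.

Lemma principal_is_ideal (A : comPzRingType) (g : A) :
  is_ideal (principal_ideal g).
Proof.
split; first by exists 0; rewrite mul0r.
  by move=> _ _ [a ->] [b ->]; exists (a + b); rewrite mulrDl.
by move=> h _ [a ->]; exists (h * a); rewrite mulrA.
Qed.

Lemma zero_is_ideal (A : comPzRingType) : is_ideal (@zero_ideal A).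
Proof.
by split=> [|f g -> ->|h f ->]; rewrite /zero_ideal ?addr0 ?mulr0.
Qed.

Lemma is_idealB (A : pzRingType) (J : A -> Prop) (f g : A) :
  is_ideal J -> J f -> J g -> J (f - g).
Proof. by case=> _ hD hM Jf Jg; apply: hD => //; rewrite -mulN1r; apply: hM. Qed.

Definition pair_ideal (A : pzRingType) (x y : A) : A -> Prop :=
  fun f => exists a b, f = a * x + b * y.

Lemma pair_is_ideal (A : comPzRingType) (x y : A) : is_ideal (pair_ideal x y).
Proof.
split; first by exists 0, 0; rewrite !mul0r addr0.
  by move=> _ _ [a [b ->]] [c [e ->]]; exists (a + c), (b + e); ring.
by move=> h _ [a [b ->]]; exists (h * a), (h * b); ring.
Qed.

(** Modulo [J] the ring morphism given by [sg] fixes each variable, hence each polynomial; so its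
    kernel lies in [J]. *)
Lemma comp_mpoly_sub_ideal (C : fieldType) (N : nat) (J : {mpoly C[N]} -> Prop)
    (sg : N.-tuple {mpoly C[N]}) (f : {mpoly C[N]}) :
  is_ideal J -> (forall i, J ('X_i - tnth sg i)) -> J (f - (f \mPo sg)).
Proof.
move=> hJ hsg; have [J0 JD JM] := hJ.
have J1 p q : J (p - (p \mPo sg)) -> J (q - (q \mPo sg)) ->
    J (p * q - ((p * q) \mPo sg)).
  move=> Jp Jq; rewrite rmorphM /=.
  have -> : p * q - (p \mPo sg) * (q \mPo sg) =
    q * (p - (p \mPo sg)) + (p \mPo sg) * (q - (q \mPo sg)) by ring.
  by apply: JD; apply: JM.
elim/mpolyind: f => [|c m p _ _ Jp]; first by rewrite comp_mpoly0 subr0.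
rewrite comp_mpolyD opprD addrACA; apply: JD => //.
rewrite comp_mpolyZ -scalerBr -mul_mpolyC; apply: JM.
rewrite mpolyXE_id; elim/big_ind: _ => [|p1 p2|i _]; last 2 first.
- exact: J1.
- elim: (m i) => [|e IH]; first by rewrite expr0 rmorph1 subrr.
  rewrite exprS; apply: J1 => //.
  by rewrite comp_mpolyXU -tnth_nth.
by rewrite rmorph1 subrr.
Qed.

(** * Nonzerodivisors modulo powers of linear forms *)

Lemma linear_formE (C : fieldType) (N : nat) (L : {mpoly C[N]}) :
  L \is 1.-homog -> L = \sum_j L@_U_(j) *: 'X_j.
Proof.
move=> hL; apply/mpolyP => m; rewrite raddf_sum /=.
have [/mdeg1P[j /eqP ->]|nm] := boolP (mdeg m == 1%N).
  rewrite (bigD1 j) //= mcoeffZ mcoeffX eqxx mulr1 big1 ?addr0 // => i nij.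
  by rewrite mcoeffZ mcoeffX eq_mnm1 (negbTE nij) mulr0.
rewrite (dhomog_nemf_coeff hL nm) big1 // => i _.
rewrite mcoeffZ mcoeffX; case: eqP => [e|]; rewrite ?mulr0 //.
by move: nm; rewrite -e mdeg1.
Qed.

Lemma linear_form_neq0 (C : fieldType) (N : nat) (L : {mpoly C[N]}) :
  L \is 1.-homog -> L != 0 -> exists l, L@_U_(l) != 0.
Proof.
move=> hL; apply: contraNP => nl; rewrite (linear_formE hL) big1 // => j _.
by case: (eqVneq L@_U_(j) 0) => [->|nj]; [rewrite scale0r|case: nl; exists j].
Qed.

(* The substitution [sg] solves [L = 0] for ['X_l]; it retracts the polynomial
   ring onto a subring and its kernel is [(L)]. *)
Lemma linear_form_prime (C : fieldType) (N : nat) (L f g : {mpoly C[N]}) :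
  L \is 1.-homog -> L != 0 -> principal_ideal L (f * g) ->
  principal_ideal L f \/ principal_ideal L g.
Proof.
move=> hL nzL; have [l nzl] := linear_form_neq0 hL nzL.
set c := L@_U_(l) in nzl.
pose sg := [tuple if i == l then 'X_l - c^-1 *: L else 'X_i | i < N].
have hsg i : principal_ideal L ('X_i - tnth sg i).
  rewrite tnth_mktuple; case: eqP => [->|_]; last first.
    by exists 0; rewrite subrr mul0r.
  by exists (c^-1)%:MP; rewrite opprB addrCA subrr addr0 mul_mpolyC.
have hJ := principal_is_ideal L.
have sL : L \mPo sg = 0.
  rewrite {1}(linear_formE hL) raddf_sum /=.
  rewrite (eq_bigr (fun j => L@_U_(j) *: 'X_j - (if j == l then L else 0))).
    by rewrite big_split /= -linear_formE // sumrN -big_mkcond big_pred1_eq subrr.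
  move=> j _; rewrite comp_mpolyZ comp_mpolyXU -tnth_nth tnth_mktuple.
  case: eqP => [->|_]; last by rewrite subr0.
  by rewrite scalerBr scalerA divff // scale1r.
have keyP p : p \mPo sg = 0 -> principal_ideal L p.
  by move=> p0; have := comp_mpoly_sub_ideal p hJ hsg; rewrite p0 subr0.
case=> h fgE; have /eqP : (f * g) \mPo sg = 0 by rewrite fgE rmorphM /= sL mulr0.
by rewrite rmorphM mulf_eq0 => /orP[]/eqP/keyP; [left|right].
Qed.

(** Primality of [L] removes one factor [L] at a time. *)
Lemma linear_form_power_reg (C : fieldType) (N k : nat) (L f g : {mpoly C[N]}) :
  L \is 1.-homog -> L != 0 -> ~ principal_ideal L g ->
  principal_ideal (L ^+ k) (g * f) -> principal_ideal (L ^+ k) f.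
Proof.
move=> hL nzL ng; elim: k f => [|k IH] f; first by exists f; rewrite mulr1.
case=> h fgE; have : principal_ideal L (g * f).
  by exists (h * L ^+ k); rewrite fgE exprSr mulrA.
case/(linear_form_prime hL nzL) => // -[f' f'E].
have [|h' h'E] := IH f'.
  exists h; apply: (mulIf nzL).
  by rewrite -mulrA -f'E fgE exprSr mulrA.
by exists h'; rewrite f'E h'E exprSr mulrA.
Qed.

(** The substitution [sg] kills ['X_a], solves [L = 0] for ['X_l] and fixes ['X_b]. Its kernel is
    the ideal of ['X_a] and [L], and its target is a domain, so ['X_b] can be cancelled. *)
Lemma pair_linear_prime (C : fieldType) (N : nat) (L f : {mpoly C[N]})
    (a b l : 'I_N) :
  L \is 1.-homog -> L@_U_(l) != 0 -> a != l -> b != a -> b != l ->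
  pair_ideal 'X_a L ('X_b * f) -> pair_ideal 'X_a L f.
Proof.
move=> hL nzl nal nba nbl; set c := L@_U_(l) in nzl.
pose sg := [tuple if i == a then 0 else
  if i == l then 'X_l - c^-1 *: (L - L@_U_(a) *: 'X_a) else 'X_i | i < N].
have hJ := pair_is_ideal 'X_a L.
have hsg i : pair_ideal 'X_a L ('X_i - tnth sg i).
  rewrite tnth_mktuple; case: eqP => [->|_].
    by exists 1, 0; rewrite subr0 mul1r mul0r addr0.
  case: eqP => [->|_]; last by rewrite subrr; case: hJ.
  exists (- c^-1 * L@_U_(a))%:MP, (c^-1)%:MP.
  rewrite !mul_mpolyC opprB addrCA subrr addr0 scalerBr scalerA mulNr scaleNr.
  by rewrite addrC.
have sL : L \mPo sg = 0.
  rewrite {1}(linear_formE hL) raddf_sum /=.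
  rewrite (eq_bigr (fun j => L@_U_(j) *: 'X_j
    - ((if j == l then L - L@_U_(a) *: 'X_a else 0)
      + (if j == a then L@_U_(a) *: 'X_a else 0)))).
    rewrite big_split /= -linear_formE // sumrN big_split /= -!big_mkcond.
    by rewrite !big_pred1_eq subrK subrr.
  move=> j _; rewrite comp_mpolyZ comp_mpolyXU -tnth_nth tnth_mktuple.
  case: (eqVneq j a) => [->|_].
    by rewrite (negbTE nal) add0r subrr scaler0.
  case: eqP => [->|_]; last by rewrite addr0 subr0.
  by rewrite addr0 scalerBr [in LHS]scalerA divff // scale1r.
case=> u [v uvE].
have : ('X_b * f) \mPo sg = 0.
  rewrite uvE rmorphD !rmorphM /= sL comp_mpolyXU -tnth_nth tnth_mktuple.
  by rewrite eqxx !mulr0 addr0.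
rewrite rmorphM /= comp_mpolyXU -tnth_nth tnth_mktuple (negbTE nba) (negbTE nbl).
move/eqP; rewrite mulf_eq0 -msupp_eq0 msuppX /= => /eqP f0.
by have := comp_mpoly_sub_ideal f hJ hsg; rewrite f0 subr0.
Qed.

(** The point [v] lies on the hyperplane [L = 0], but its coordinate [a] is 1. *)
Lemma X_not_multiple (C : fieldType) (N : nat) (L : {mpoly C[N]}) (a l : 'I_N) :
  L \is 1.-homog -> L@_U_(l) != 0 -> a != l -> ~ principal_ideal L 'X_a.
Proof.
move=> hL nzl nal [h hE].
pose v j := if j == a then 1 else if j == l then - L@_U_(a) / L@_U_(l) else 0.
have Lv : L.@[v] = 0.
  rewrite (linear_formE hL) raddf_sum /= (bigD1 a) //= (bigD1 l) 1?eq_sym //=.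
  rewrite big1 => [|j /andP[/negbTE ja /negbTE jl]]; last first.
    by rewrite mevalZ mevalXU /v ja jl mulr0.
  rewrite !mevalZ !mevalXU /v !eqxx eq_sym (negbTE nal) mulr1 addr0.
  by rewrite mulrC divfK // subrr.
have := congr1 (meval v) hE; rewrite mevalM Lv mulr0 mevalXU /v eqxx.
by move/eqP; rewrite oner_eq0.
Qed.

Lemma X_power_reg (C : fieldType) (N k e : nat) (L f : {mpoly C[N]})
    (a l : 'I_N) :
  L \is 1.-homog -> L@_U_(l) != 0 -> a != l ->
  principal_ideal (L ^+ k) ('X_a ^+ e * f) -> principal_ideal (L ^+ k) f.
Proof.
move=> hL nzl nal; have nzL : L != 0 by apply: contraNneq nzl => ->; rewrite mcoeff0.
elim: e => [|e IH]; first by rewrite mul1r.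
rewrite exprS -mulrA => h; apply: IH; move: h.
exact/linear_form_power_reg/(X_not_multiple hL nzl nal).
Qed.

(** Two inductions starting from the ideal of ['X_a] and [L]: first on the exponent of [L], which
    cancels modulo ['X_a]; then on the exponent of ['X_a], which cancels modulo [L ^+ k]. *)
Lemma pair_power_reg1 (C : fieldType) (N k p : nat) (L f : {mpoly C[N]})
    (a b l : 'I_N) :
  L \is 1.-homog -> L@_U_(l) != 0 -> a != l -> b != a -> b != l ->
  pair_ideal ('X_a ^+ p) (L ^+ k) ('X_b * f) ->
  pair_ideal ('X_a ^+ p) (L ^+ k) f.
Proof.
move=> hL nzl nal nba nbl.
have hX : ('X_a : {mpoly C[N]}) \is 1.-homog by rewrite dhomogX /= mdeg1.
have nzX : ('X_a : {mpoly C[N]}) != 0 by rewrite -msupp_eq0 msuppX.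
have nXL : ~ principal_ideal 'X_a L.
  case=> h /(congr1 (meval (fun j => (j == l)%:R))).
  rewrite mevalM mevalXU (negbTE nal) mulr0 (linear_formE hL) raddf_sum /=.
  rewrite (bigD1 l) //= big1 => [|j /negbTE jl]; rewrite mevalZ mevalXU.
    by rewrite eqxx mulr1 addr0 => /eqP; rewrite (negbTE nzl).
  by rewrite jl mulr0.
have base j g : pair_ideal 'X_a (L ^+ j) ('X_b * g) -> pair_ideal 'X_a (L ^+ j) g.
  elim: j g => [|j IH] g; first by exists 0, g; rewrite mul0r add0r mulr1.
  case=> u [v uvE].
  have [|u' [v' gE]] := pair_linear_prime (f := g) hL nzl nal nba nbl.
    by exists u, (v * L ^+ j); rewrite uvE exprSr mulrA.
  (* Comparing the two expressions of ['X_b * g] leaves a multiple of [L] that vanishes modulo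
     ['X_a]; there [L] is cancelled. *)
  have : principal_ideal 'X_a (L * ('X_b * v' - v * L ^+ j)).
    exists (u - 'X_b * u'); rewrite mulrBl; apply/eqP.
    rewrite -subr_eq0; apply/eqP.
    transitivity ('X_b * (u' * 'X_a + v' * L) - (u * 'X_a + v * L ^+ j.+1)).
      by rewrite exprSr; ring.
    by rewrite -gE uvE subrr.
  case/(linear_form_prime hX nzX) => // -[w wE].
  have [|x [y v'E]] := IH v'.
    by exists w, v; rewrite -wE subrK.
  by exists (u' + x * L), y; rewrite gE v'E exprSr; ring.
elim: p f => [|p IH] f; first by exists f, 0; rewrite mul0r addr0 mulr1.
case=> u [v uvE].
have [|u' [v' fE]] := base k f.
  by exists (u * 'X_a ^+ p), v; rewrite uvE exprSr mulrA.
have : principal_ideal (L ^+ k) ('X_a ^+ 1 * ('X_b * u' - u * 'X_a ^+ p)).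
  exists (v - 'X_b * v'); rewrite expr1; apply/eqP.
  rewrite -subr_eq0; apply/eqP.
  transitivity ('X_b * (u' * 'X_a + v' * L ^+ k)
                - (u * 'X_a ^+ p.+1 + v * L ^+ k)).
    by rewrite exprSr; ring.
  by rewrite -fE uvE subrr.
case/(X_power_reg hL nzl nal) => w wE.
have [|x [y u'E]] := IH u'.
  by exists u, w; rewrite -wE addrC subrK.
by exists x, (y * 'X_a + v'); rewrite fE u'E exprSr; ring.
Qed.

Lemma pair_power_reg (C : fieldType) (N k p q : nat) (L f : {mpoly C[N]})
    (a b l : 'I_N) :
  L \is 1.-homog -> L@_U_(l) != 0 -> a != l -> b != a -> b != l ->
  pair_ideal ('X_a ^+ p) (L ^+ k) ('X_b ^+ q * f) ->
  pair_ideal ('X_a ^+ p) (L ^+ k) f.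
Proof.
move=> hL nzl nal nba nbl; elim: q => [|q IH]; first by rewrite mul1r.
by rewrite exprS -mulrA => /(pair_power_reg1 hL nzl nal nba nbl)/IH.
Qed.

Lemma pihomog_principal (C : fieldType) (N k e : nat) (L f : {mpoly C[N]}) :
  L \is 1.-homog -> principal_ideal (L ^+ k) f ->
  principal_ideal (L ^+ k) (pihomog mdeg e f).
Proof.
move=> hL [h ->].
have hLk : L ^+ k \is k.-homog by rewrite -[k in k.-homog]mul1n; apply: dhomogMn.
have [le_ke|lt_ek] := leqP k e; last first.
  by exists 0; rewrite mul0r (pihomogMr_small _ hLk).
by exists (pihomog mdeg (e - k) h); rewrite -{1}(subnK le_ke) pihomogMr.
Qed.

(** * Global sections on the hypersurface of a power of a linear form *)

Lemma eq_frac_reg (C : fieldType) (N k : nat) (L f g u v : {mpoly C[N]})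
    (a l : 'I_N) :
  L \is 1.-homog -> L@_U_(l) != 0 -> a != l ->
  eq_frac (principal_ideal (L ^+ k)) 'X_a f u g v ->
  principal_ideal (L ^+ k) (v * f - u * g).
Proof. by move=> hL nzl nal [e /(X_power_reg hL nzl nal)]. Qed.

Lemma other_index (N : nat) (a : 'I_N) : (1 < N)%N -> exists l : 'I_N, a != l.
Proof.
case: N a => [|[|N]] a // _; have [->|na] := eqVneq a ord0.
  by exists ord_max.
by exists ord0.
Qed.

(** Another index with nonzero coefficient shows that [L] divides neither ['X_a] nor ['X_b]; both
    are nonzerodivisors modulo [L ^+ k], so the clearing power drops out. *)
Lemma eq_frac2_reg (C : fieldType) (N k : nat) (L f g u v : {mpoly C[N]})
    (a b : 'I_N) :
  L \is 1.-homog -> (forall l, L@_U_(l) != 0) -> (1 < N)%N ->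
  eq_frac (principal_ideal (L ^+ k)) ('X_a * 'X_b) f u g v ->
  principal_ideal (L ^+ k) (v * f - u * g).
Proof.
move=> hL nzL N1 [e]; rewrite exprMn -mulrA.
have [la nal] := other_index a N1; have [lb nbl] := other_index b N1.
move/(X_power_reg hL (nzL la) nal); exact/(X_power_reg hL (nzL lb) nbl).
Qed.

(* ['X_a], ['X_b] is a regular sequence modulo [L ^+ k], so the charts [a] and [b]
   alone already force the section to be a polynomial. *)
Lemma H0_power_section (C : fieldType) (N k t : nat) (L : {mpoly C[N]})
    (s : carrier (H0 (principal_ideal (L ^+ k)) t%:Z)) :
  L \is 1.-homog -> (forall l, L@_U_(l) != 0) -> (2 < N)%N -> mem_sq s ->
  exists g, g \is t.-homog /\
    forall c, principal_ideal (L ^+ k) ((s c).1 - 'X_c ^+ (s c).2 * g).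
Proof.
move=> hL nzL N2 [s_deg s_glue]; have N1 := ltnW N2.
pose a : 'I_N := Ordinal (ltnW N1); pose b : 'I_N := Ordinal N1.
pose l : 'I_N := Ordinal N2.
have nzX (c : 'I_N) : exists l, c != l by exact: other_index.
have [h hE] := eq_frac2_reg hL nzL N1 (s_glue a b).
(* Glueing puts a power of ['X_b] times [(s a).1] into the ideal of ['X_a ^+ (s a).2] and [L ^+ k].
   Cancelling that power makes [(s a).1] divisible by ['X_a ^+ (s a).2] modulo [L ^+ k], with
   quotient [g]. *)
have [|g [w gwE]] := @pair_power_reg _ _ k (s a).2 (s b).2 L (s a).1 a b l hL
    (nzL l) isT isT isT.
  exists (s b).1, h; rewrite -hE; ring.
have hXp : ('X_a ^+ (s a).2 : {mpoly C[N]}) \is (s a).2.-homog.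
  by rewrite -[X in X.-homog]mul1n; apply: dhomogMn; rewrite dhomogX /= mdeg1.
exists (pihomog mdeg t g); split=> [|c]; first exact: pihomogP.
set g0 := pihomog mdeg t g.
have ga : principal_ideal (L ^+ k) ((s a).1 - 'X_a ^+ (s a).2 * g0).
  have sa : (s a).1 \is (t + (s a).2).-homog := s_deg a.
  rewrite [_ * g0]mulrC -(pihomogMr t g hXp) -{1}(pihomog_dE sa) -raddfB /=.
  apply: pihomog_principal => //; exists w.
  by rewrite gwE addrAC subrr add0r.
have [l' nal'] := nzX a.
(* On a chart [c] the claim is checked after multiplication by a power of ['X_a], where glueing
   reduces it to the chart [a]. *)
apply: (@X_power_reg _ _ k (s a).2 L _ a l' hL (nzL l') nal').
have gac := eq_frac2_reg hL nzL N1 (s_glue a c).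
have hJ := principal_is_ideal (L ^+ k); have [_ _ JM] := hJ.
have -> : 'X_a ^+ (s a).2 * ((s c).1 - 'X_c ^+ (s c).2 * g0) =
  'X_c ^+ (s c).2 * ((s a).1 - 'X_a ^+ (s a).2 * g0) -
  ('X_c ^+ (s c).2 * (s a).1 - 'X_a ^+ (s a).2 * (s c).1) by ring.
exact: is_idealB (JM _ _ ga) gac.
Qed.

(** * The diagram in at least three variables *)

Lemma in_degreeB (C : fieldType) (N e k : nat) (f : {mpoly C[N]}) :
  in_degree (e%:Z - k%:Z) f = if (k <= e)%N then f \is (e - k).-homog else f == 0.
Proof.
have [le_ke|lt_ek] := leqP k e; first by rewrite subzn.
by rewrite -opprB subzn 1?ltnW // -(subnSK lt_ek) -NegzE.
Qed.

Lemma power_homog (C : fieldType) (N k : nat) (L : {mpoly C[N]}) :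
  L \is 1.-homog -> L ^+ k \is k.-homog.
Proof. by move=> hL; rewrite -[X in X.-homog]mul1n; apply: dhomogMn. Qed.

Lemma in_degree_mulX (C : fieldType) (N e k : nat) (L f : {mpoly C[N]}) :
  L \is 1.-homog -> in_degree (e%:Z - k%:Z) f -> L ^+ k * f \is e.-homog.
Proof.
move=> hL; rewrite in_degreeB; have [le_ke hf|_ /eqP ->] := leqP k e.
  by rewrite -(subnKC le_ke); apply: dhomogM hf; apply: power_homog.
by rewrite mulr0 dhomog0.
Qed.

Lemma principal_in_degree (C : fieldType) (N e k : nat) (L y : {mpoly C[N]}) :
  L \is 1.-homog -> y \is e.-homog -> principal_ideal (L ^+ k) y ->
  exists2 f, in_degree (e%:Z - k%:Z) f & y = L ^+ k * f.
Proof.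
move=> hL hy [h yE]; have hLk := power_homog k hL.
have [le_ke|lt_ek] := leqP k e.
  exists (pihomog mdeg (e - k) h); first by rewrite in_degreeB le_ke pihomogP.
  by rewrite mulrC -(pihomogMr _ _ hLk) subnK // -yE pihomog_dE.
exists 0; first by rewrite in_degreeB leqNgt lt_ek eqxx.
by rewrite mulr0 -(pihomog_dE hy) yE (pihomogMr_small _ hLk).
Qed.

(** Like [SLP_surjective], indexed by the degree [e] of the target; the source degree [e - k] may be
    negative, and then the source is zero. *)
Definition SLP_injective (C : fieldType) (N r : nat) (F : 'I_r -> {mpoly C[N]})
    (e k : nat) (L : {mpoly C[N]}) : Prop :=
  forall f, in_degree (e%:Z - k%:Z) f -> ideal_gen F (L ^+ k * f) ->
    ideal_gen F f.

Definition SLP_surjective (C : fieldType) (N r : nat) (F : 'I_r -> {mpoly C[N]})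
    (e k : nat) (L : {mpoly C[N]}) : Prop :=
  forall y, y \is e.-homog ->
    exists2 f, in_degree (e%:Z - k%:Z) f & ideal_gen F (L ^+ k * f - y).

Lemma in_degreeD (C : fieldType) (N : nat) (t : int) (f g : {mpoly C[N]}) :
  in_degree t f -> in_degree t g -> in_degree t (f + g).
Proof.
case: t => m; first exact: dhomogD.
by move=> /eqP -> /eqP ->; rewrite /= addr0.
Qed.

Lemma in_degreeN (C : fieldType) (N : nat) (t : int) (f : {mpoly C[N]}) :
  in_degree t f -> in_degree t (- f).
Proof. by case: t => m /=; rewrite ?dhomogN ?oppr_eq0. Qed.

Lemma in_degree0 (C : fieldType) (N : nat) (t : int) :
  in_degree t (0 : {mpoly C[N]}).
Proof. by case: t => m /=; rewrite ?dhomog0 ?eqxx. Qed.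

Lemma SLP_maximal_rank (C : fieldType) (N r : nat) (F : 'I_r -> {mpoly C[N]})
    (d i k : nat) (L : {mpoly C[N]}) :
  maximal_rank (mul_power (I := ideal_gen F) L k (j := d%:Z + i%:Z - k%:Z)) <->
  SLP_injective F (i + d) k L \/ SLP_surjective F (i + d) k L.
Proof.
rewrite /maximal_rank /sq_injective /sq_surjective /SLP_injective.
rewrite /SLP_surjective /mul_power /= !subrK -!PoszD addnC.
split=> -[h|h]; [left|right|left|right].
- by move=> f hf If; have := h f 0 hf (in_degree0 _ _ _); rewrite mulr0 !subr0; apply.
- by move=> y /h[f [hf Ify]]; exists f.
- move=> f g hf hg; rewrite -mulrBr; apply: h.
  by apply: in_degreeD => //; apply: in_degreeN.
- by move=> y /h[f hf Ify]; exists f.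
Qed.

(** Denominators multiply up along the sum of fractions; the invariant compares each partial sum
    with a fraction over the fixed denominator ['X_j ^+ M]. *)
Lemma H0_Phi_chart (C : fieldType) (N r d M : nat) (F : 'I_r -> {mpoly C[N]})
    (J : {mpoly C[N]} -> Prop) (t : int) (a : carrier (sq_power r (H0 J t)))
    (j : 'I_N) (g : 'I_r -> {mpoly C[N]}) :
  is_ideal J ->
  (forall s, J ('X_j ^+ M * (a s j).1 - 'X_j ^+ (a s j).2 * g s)) ->
  J ('X_j ^+ M * (H0_Phi d F a j).1
     - 'X_j ^+ (H0_Phi d F a j).2 * \sum_(s < r) g s * F s).
Proof.
move=> hJ hg; have [J0 JD JM] := hJ.
apply: (big_ind2 (fun (b : fraction C N) f =>
  J ('X_j ^+ M * b.1 - 'X_j ^+ b.2 * f))) => [|b f c h Jb Jc|s _] /=.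
- by rewrite !mulr0 subr0.
- have -> : 'X_j ^+ M * ('X_j ^+ c.2 * b.1 + 'X_j ^+ b.2 * c.1)
      - 'X_j ^+ (b.2 + c.2) * (f + h) =
    'X_j ^+ c.2 * ('X_j ^+ M * b.1 - 'X_j ^+ b.2 * f) +
    'X_j ^+ b.2 * ('X_j ^+ M * c.1 - 'X_j ^+ c.2 * h) by rewrite exprD; ring.
  by apply: JD; apply: JM.
- have -> : 'X_j ^+ M * (F s * (a s j).1) - 'X_j ^+ (a s j).2 * (g s * F s) =
    F s * ('X_j ^+ M * (a s j).1 - 'X_j ^+ (a s j).2 * g s) by ring.
  exact: JM.
Qed.

Definition represents (C : fieldType) (N : nat) (J : {mpoly C[N]} -> Prop)
    (s : 'I_N -> fraction C N) (g : {mpoly C[N]}) : Prop :=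
  forall c, J ((s c).1 - 'X_c ^+ (s c).2 * g).

Definition poly_section (C : fieldType) (N : nat) (g : {mpoly C[N]}) :
    'I_N -> fraction C N := fun=> (g, 0%N).

Lemma represents_poly_section (C : fieldType) (N : nat)
    (J : {mpoly C[N]} -> Prop) (g : {mpoly C[N]}) :
  is_ideal J -> represents J (poly_section g) g.
Proof. by case=> J0 _ _ c; rewrite mul1r subrr. Qed.

Lemma mem_poly_section (C : fieldType) (N t : nat) (J : {mpoly C[N]} -> Prop)
    (g : {mpoly C[N]}) :
  is_ideal J -> g \is t.-homog ->
  mem_sq (poly_section g : carrier (H0 J t%:Z)).
Proof.
case=> J0 _ _ hg; split=> [j|j l]; first by rewrite /= addn0.
by exists 0%N; rewrite !mul1r subrr.
Qed.

Lemma represents_Phi (C : fieldType) (N r d : nat) (F : 'I_r -> {mpoly C[N]})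
    (J : {mpoly C[N]} -> Prop) (t : int) (a : carrier (sq_power r (H0 J t)))
    (g : 'I_r -> {mpoly C[N]}) :
  is_ideal J -> (forall s, represents J (a s) (g s)) ->
  represents J (H0_Phi d F a) (\sum_(s < r) g s * F s).
Proof.
move=> hJ hg c; have := @H0_Phi_chart _ _ _ d 0 F J t a c g hJ.
by rewrite mul1r; apply=> s; rewrite mul1r; apply: hg.
Qed.

Lemma represents_eq (C : fieldType) (N k : nat) (t : int) (L : {mpoly C[N]})
    (s s' : carrier (H0 (principal_ideal (L ^+ k)) t)) (g g' : {mpoly C[N]}) :
  L \is 1.-homog -> (forall l, L@_U_(l) != 0) -> (1 < N)%N ->
  represents (principal_ideal (L ^+ k)) s g ->
  represents (principal_ideal (L ^+ k)) s' g' ->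
  eq_sq s s' <-> principal_ideal (L ^+ k) (g - g').
Proof.
move=> hL nzL N1 sg sg'; have hJ := principal_is_ideal (L ^+ k).
have [_ JD JM] := hJ.
split=> [ss'|gg' c].
  pose c : 'I_N := Ordinal N1; have [l ncl] := other_index c N1.
  have h := eq_frac_reg hL (nzL l) ncl (ss' c).
  apply: (@X_power_reg _ _ k ((s c).2 + (s' c).2) L _ c l hL (nzL l) ncl).
  have -> : 'X_c ^+ ((s c).2 + (s' c).2) * (g - g') =
    ('X_c ^+ (s' c).2 * (s c).1 - 'X_c ^+ (s c).2 * (s' c).1)
    + 'X_c ^+ (s c).2 * ((s' c).1 - 'X_c ^+ (s' c).2 * g')
    - 'X_c ^+ (s' c).2 * ((s c).1 - 'X_c ^+ (s c).2 * g) by rewrite exprD; ring.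
  exact: is_idealB (JD _ _ h (JM _ _ (sg' c))) (JM _ _ (sg c)).
exists 0%N; rewrite mul1r.
have -> : 'X_c ^+ (s' c).2 * (s c).1 - 'X_c ^+ (s c).2 * (s' c).1 =
  ('X_c ^+ (s' c).2 * ((s c).1 - 'X_c ^+ (s c).2 * g)
  + 'X_c ^+ ((s c).2 + (s' c).2) * (g - g'))
  - 'X_c ^+ (s c).2 * ((s' c).1 - 'X_c ^+ (s' c).2 * g') by rewrite exprD; ring.
exact: is_idealB (JD _ _ (JM _ _ (sg c)) (JM _ _ gg')) (JM _ _ (sg' c)).
Qed.

(** A polynomial syzygy of degree [i] defines a global section of [K(i)], and a polynomial that is
    zero on one chart is zero. *)
Lemma no_syzygy (C : fieldType) (n r d i : nat) (F : 'I_r -> {mpoly C[n.+1]})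
    (c : 'I_r -> {mpoly C[n.+1]}) :
  h0_K_eq0 d F i%:Z -> (forall s, c s \is i.-homog) ->
  \sum_(s < r) c s * F s = 0 -> forall s, c s = 0.
Proof.
move=> hK hc c0 s; have hJ := zero_is_ideal {mpoly C[n.+1]}.
have hPhi := represents_Phi d F (t := i%:Z)
  (a := fun s => poly_section (c s)) hJ (fun s => represents_poly_section (c s) hJ).
have [|e] := hK (fun s => poly_section (c s)) _ s ord0.
  split=> [s'|j]; first exact: mem_poly_section.
  by exists 0%N; have := hPhi j; rewrite c0 !mulr0 !mul1r !subr0.
rewrite /zero_ideal /= !mul1r subr0 => /eqP.
by rewrite mulf_eq0 expf_eq0 -msupp_eq0 msuppX andbF => /eqP.
Qed.

Lemma maximal_rank_iff (C : fieldType) (N r d i k : nat)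
    (F : 'I_r -> {mpoly C[N]}) (L : {mpoly C[N]}) :
  (forall s, F s \is d.-homog) ->
  (forall c, (forall s, c s \is i.-homog) ->
     \sum_(s < r) c s * F s = 0 -> forall s, c s = 0) ->
  (2 < N)%N -> L \is 1.-homog -> (forall l, L@_U_(l) != 0) ->
  maximal_rank (mul_power (I := ideal_gen F) L k (j := d%:Z + i%:Z - k%:Z)) <->
  maximal_rank (H0_Phi d F (J := principal_ideal (L ^+ k)) (t := i%:Z)).
Proof.
move=> hF hK N2 hL nzL; rewrite SLP_maximal_rank.
set J := principal_ideal (L ^+ k); have hJ : is_ideal J by exact: principal_is_ideal.
have N1 := ltnW N2; have [J0 JD JM] := hJ.
have hI := ideal_gen_ideal F; have [I0 ID IM] := hI.
have Jpoly (a : carrier (sq_power r (H0 J i%:Z))) : mem_sq a ->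
    exists g : 'I_r -> {mpoly C[N]},
      (forall s, g s \is i.-homog) /\ forall s, represents J (a s) (g s).
  move=> ha; have /choice[g hg] : forall s, exists g,
      g \is i.-homog /\ represents J (a s) g.
    by move=> s; exact: H0_power_section (ha s).
  by exists g; split=> s; case: (hg s).
have Jsum (c : 'I_r -> {mpoly C[N]}) : (forall s, c s \is i.-homog) ->
    \sum_(s < r) c s * F s \is (i + d).-homog.
  by move=> hc; apply: rpred_sum => s _; apply: dhomogM.
split=> -[h|h]; [left|right|left|right].
(* The difference [b] of two sections with equal image satisfies [\sum_s b s * F s = L ^+ k * f].
   Then [f] is in the ideal, say [f = \sum_s c s * F s], and [b - L ^+ k * c] is a syzygy of degree
   [i], hence zero. *)
- move=> a a' /Jpoly[g [hg ag]] /Jpoly[g' [hg' ag']].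
  rewrite (represents_eq hL nzL N1 (represents_Phi d F hJ ag)
    (represents_Phi d F hJ ag')) => Jgg' s.
  rewrite (represents_eq hL nzL N1 (ag s) (ag' s)).
  pose b s := g s - g' s.
  have hb s' : b s' \is i.-homog by apply: rpredB.
  have bE : \sum_(s < r) b s * F s = \sum_(s < r) g s * F s - \sum_(s < r) g' s * F s.
    by rewrite -sumrB; apply: eq_bigr => s' _; rewrite mulrBl.
  rewrite -bE in Jgg'.
  have [f hf fE] := principal_in_degree hL (Jsum b hb) Jgg'.
  have If : ideal_gen F f by apply: h => //; rewrite -fE; exists b.
  have [c [hc cE]] : exists c : 'I_r -> {mpoly C[N]},
      (forall s, L ^+ k * c s \is i.-homog) /\ f = \sum_(s < r) c s * F s.
    move: hf; rewrite in_degreeB; case: leqP => [le_k hf|_ /eqP f0]; last first.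
      exists (fun=> 0); split=> [s'|]; first by rewrite mulr0 dhomog0.
      by rewrite f0 big1 // => s' _; rewrite mul0r.
    (* For [i < k] the degree of [f] is below that of the generators, which forces [f = 0]. *)
    have [le_ki|lt_ik] := leqP k i.
      rewrite -addnBAC // in hf.
      have [c [hc cE]] := ideal_gen_homog hF hf If.
      exists c; split=> // s'; rewrite -(subnKC le_ki).
      by apply: dhomogM (hc s'); apply: power_homog.
    exists (fun=> 0); split=> [s'|]; first by rewrite mulr0 dhomog0.
    rewrite big1 => [|s' _]; last by rewrite mul0r.
    apply: ideal_gen_homog_small hF hf _ If.
    by rewrite ltn_subLR // ltn_add2r.
  have := hK (fun s => b s - L ^+ k * c s) _ _ s; rewrite /b => h0.
  exists (c s); apply/eqP; rewrite mulrC -subr_eq0; apply/eqP; apply: h0 => [s'|].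
    exact: rpredB (hb s') (hc s').
  rewrite (eq_bigr (fun s => b s * F s - L ^+ k * (c s * F s))).
    by rewrite sumrB -mulr_sumr -cE -fE subrr.
  by move=> s' _; rewrite mulrBl mulrA.
- move=> y hy; have [g [hg yg]] : exists g, g \is (i + d).-homog /\ represents J y g.
    exact: H0_power_section hy.
  have [f hf Ifg] := h g hg.
  (* Subtracting [L ^+ k * f] does not change the section, and the difference is a combination of
     the [F s] with coefficients of degree [i]. *)
  have hgf : g - L ^+ k * f \is (i + d).-homog.
    by apply: rpredB; rewrite ?in_degree_mulX.
  have [|a [ha aE]] := ideal_gen_homog hF hgf.
    by rewrite -opprB -mulN1r; apply: IM.
  exists (fun s => poly_section (a s)); split=> [s|]; first exact: mem_poly_section.
  have aP s := represents_poly_section (a s) hJ.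
  rewrite (represents_eq hL nzL N1 (represents_Phi d F hJ aP) yg) -aE.
  by exists (- f); rewrite addrAC subrr add0r mulNr mulrC.
(* Writing [L ^+ k * f] as [\sum_s a s * F s] gives sections [a] that are sent to zero modulo
   [L ^+ k]; so each [a s] is a multiple of [L ^+ k], which then cancels. *)
- move=> f hf If.
  have hLf : L ^+ k * f \is (i + d).-homog by exact: in_degree_mulX.
  have [a [ha aE]] := ideal_gen_homog hF hLf If.
  have aP s := represents_poly_section (a s) hJ.
  have zP (s : 'I_r) := represents_poly_section 0 hJ.
  pose A : carrier (sq_power r (H0 J i%:Z)) := fun s => poly_section (a s).
  pose Z : carrier (sq_power r (H0 J i%:Z)) := fun=> poly_section 0.
  have e : eq_sq (H0_Phi d F A) (H0_Phi d F Z).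
    rewrite (represents_eq hL nzL N1 (represents_Phi (a := A) d F hJ aP)
      (represents_Phi (a := Z) d F hJ zP)).
    rewrite -aE big1 => [|s _]; last by rewrite mul0r.
    by exists f; rewrite subr0 mulrC.
  have {}e s : eq_sq (A s) (Z s).
    apply: (h A Z) e s => s; first exact: mem_poly_section.
    exact/mem_poly_section/dhomog0.
  have /choice[c cE] : forall s, exists c, a s = c * L ^+ k.
    move=> s; have := e s.
    by rewrite (represents_eq hL nzL N1 (aP s) (zP s)) subr0.
  have nzLk : L ^+ k != 0.
    by apply/expf_neq0; apply: contraNneq (nzL (Ordinal N1)) => ->; rewrite mcoeff0.
  exists c; apply: (mulfI nzLk); rewrite aE mulr_sumr; apply: eq_bigr => s _.
  by rewrite cE; ring.
- move=> y hy; have yP := represents_poly_section y hJ.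
  case: (h (poly_section y) (mem_poly_section (t := i + d) hJ hy)) => a [ha e].
  case: (Jpoly a ha) => g [hg ag].
  rewrite (represents_eq hL nzL N1 (represents_Phi d F hJ ag) yP) in e.
  have hgy : \sum_(s < r) g s * F s - y \is (i + d).-homog.
    exact: rpredB (Jsum g hg) hy.
  have [f hf fE] := principal_in_degree hL hgy e.
  exists (- f); first exact: in_degreeN.
  rewrite mulrN -fE opprB addrAC subrr add0r -mulN1r; apply: IM.
  by exists g.
Qed.

(** * Openness of maximal rank *)

(** In characteristic 0 the values [n%:R] with [n < size p] are distinct, too many to be all
    roots. *)
Lemma poly_nonroot (C : numFieldType) (p : {poly C}) :
  p != 0 -> exists t, p.[t] != 0.
Proof.
move=> nzp; pose s := [seq n%:R : C | n <- iota 0 (size p)].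
have [/hasP[t _ rt]|ns] := boolP (has (fun t => p.[t] != 0) s); first by exists t.
have : all (root p) s.
  by apply/allP => t st; rewrite /root; apply: contraNT ns => nt; apply/hasP; exists t.
move=> rs; have := max_poly_roots nzp rs; rewrite size_map size_iota ltnn.
by rewrite map_inj_uniq ?iota_uniq => [/(_ isT)|] //; apply: mulrIn (oner_neq0 C).
Qed.

Definition polyfun (C : fieldType) (N : nat) (f : ('I_N -> C) -> C) : Prop :=
  exists p : {mpoly C[N]}, forall v, f v = p.@[v].

Lemma polyfun_const (C : fieldType) (N : nat) (c : C) :
  polyfun (fun _ : 'I_N -> C => c).
Proof. by exists c%:MP => v; rewrite mevalC. Qed.

Lemma polyfun_coord (C : fieldType) (N : nat) (j : 'I_N) :
  polyfun (fun v : 'I_N -> C => v j).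
Proof. by exists 'X_j => v; rewrite mevalXU. Qed.

Lemma polyfunM (C : fieldType) (N : nat) (f g : ('I_N -> C) -> C) :
  polyfun f -> polyfun g -> polyfun (fun v => f v * g v).
Proof. by case=> p pE [q qE]; exists (p * q) => v; rewrite mevalM pE qE. Qed.

Lemma polyfun_eq (C : fieldType) (N : nat) (f g : ('I_N -> C) -> C) :
  f =1 g -> polyfun f -> polyfun g.
Proof. by move=> fg [p pE]; exists p => v; rewrite -fg. Qed.

Lemma polyfun_sum (C : fieldType) (N : nat) (I : finType)
    (f : I -> ('I_N -> C) -> C) :
  (forall i, polyfun (f i)) -> polyfun (fun v => \sum_i f i v).
Proof.
move=> /choice[p pE]; exists (\sum_i p i) => v.
by rewrite raddf_sum; apply: eq_bigr => i _; rewrite pE.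
Qed.

Lemma polyfun_prod (C : fieldType) (N : nat) (I : finType)
    (f : I -> ('I_N -> C) -> C) :
  (forall i, polyfun (f i)) -> polyfun (fun v => \prod_i f i v).
Proof.
move=> /choice[p pE]; exists (\prod_i p i) => v.
by rewrite rmorph_prod; apply: eq_bigr => i _; rewrite pE.
Qed.

Lemma polyfun_det (C : fieldType) (N m : nat) (A : ('I_N -> C) -> 'M[C]_m) :
  (forall i j, polyfun (fun v => A v i j)) -> polyfun (fun v => \det (A v)).
Proof.
move=> hA; apply: polyfun_sum => s; apply: polyfunM; first exact: polyfun_const.
by apply: polyfun_prod => i; apply: hA.
Qed.

Lemma polyfun_mulmx (C : fieldType) (N m n p : nat)
    (A : ('I_N -> C) -> 'M[C]_(m, n)) (B : ('I_N -> C) -> 'M[C]_(n, p)) :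
  (forall i j, polyfun (fun v => A v i j)) ->
  (forall i j, polyfun (fun v => B v i j)) ->
  forall i j, polyfun (fun v => (A v *m B v) i j).
Proof.
move=> hA hB i j; apply: (@polyfun_eq _ _ (fun v => \sum_l A v i l * B v l j)).
  by move=> v; rewrite mxE.
by apply: polyfun_sum => l; apply: polyfunM.
Qed.

(** Along [v + t (w - v)] both functions become nonzero univariate polynomials in [t], and their
    product has a nonroot: nonempty principal open sets meet. *)
Lemma polyfun_avoid (C : numFieldType) (N : nat) (f g : ('I_N -> C) -> C)
    (v w : 'I_N -> C) :
  polyfun f -> polyfun g -> f v != 0 -> g w != 0 ->
  exists u, f u != 0 /\ g u != 0.
Proof.
pose line t j := v j + t * (w j - v j).
have restr h : polyfun h -> exists q : {poly C}, forall t, h (line t) = q.[t].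
  case=> p pE; pose h' j := (v j)%:P + 'X * (w j - v j)%:P.
  exists (\sum_(m <- msupp p) p@_m *: \prod_j h' j ^+ m j) => t.
  rewrite pE mevalE horner_sum; apply: eq_bigr => m _.
  rewrite hornerZ horner_prod; congr (_ * _); apply: eq_bigr => j _.
  by rewrite horner_exp /h' !hornerE.
move=> /restr[p pE] /restr[q qE] nf ng.
have fv : f v = p.[0].
  by rewrite -pE; congr f; apply: funext => j; rewrite /line mul0r addr0.
have gw : g w = q.[1].
  by rewrite -qE; congr g; apply: funext => j; rewrite /line mul1r addrC subrK.
have nzp : p != 0 by apply: contraNneq nf => p0; rewrite fv p0 horner0.
have nzq : q != 0 by apply: contraNneq ng => q0; rewrite gw q0 horner0.
have [t] := poly_nonroot (mulf_neq0 nzp nzq).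
by rewrite hornerM mulf_eq0 negb_or -pE -qE => /andP[]; exists (line t).
Qed.

(** [A] and [B] are one-sided inverses of the factors in a rank factorization of [M v0], so
    [A *m M v *m B] is the identity at [v0]; where its determinant is nonzero, [M v] has at least
    the rank of [M v0]. *)
Lemma mxrank_semicontinuous (C : fieldType) (N a b : nat)
    (M : ('I_N -> C) -> 'M[C]_(a, b)) (v0 : 'I_N -> C) :
  (forall i j, polyfun (fun v => M v i j)) ->
  exists f, [/\ polyfun f, f v0 != 0 &
    forall v, f v != 0 -> (\rank (M v0) <= \rank (M v))%N].
Proof.
move=> hM; pose A := pinvmx (col_base (M v0)); pose B := pinvmx (row_base (M v0)).
exists (fun v => \det (A *m M v *m B)); split.
- apply: polyfun_det; apply: polyfun_mulmx; last first.
    by move=> i j; exact: polyfun_const.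
  by apply: polyfun_mulmx => // i j; exact: polyfun_const.
- have -> : A *m M v0 *m B = 1%:M; last by rewrite det1 oner_neq0.
  rewrite /A -[X in _ *m X *m _]mulmx_base mulmxA mulVpmx ?col_base_full //.
  by rewrite mul1mx mulmxVp ?row_base_free.
- move=> v nz; have : A *m M v *m B \in unitmx by rewrite unitmxE unitfE.
  move/mxrank_unit => {1}<-.
  exact: leq_trans (mxrankM_maxl _ _) (mxrankM_maxr _ _).
Qed.

(** A subspace of largest dimension inside [P] contains every [v] satisfying [P], since adding the
    line of [v] stays inside [P]. *)
Lemma vspace_of_closed (K : fieldType) (V : vectType K) (P : V -> Prop) :
  P 0 -> (forall a u v, P u -> P v -> P (a *: u + v)) ->
  exists U : {vspace V}, forall v, v \in U <-> P v.
Proof.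
move=> P0 PD.
pose Q m := `[< exists U : {vspace V}, \dim U = m /\ forall v, v \in U -> P v >].
have exQ : exists m, Q m.
  exists 0%N; apply/asboolP; exists 0%VS; rewrite dimv0; split=> // v.
  by rewrite memv0 => /eqP ->.
have ubQ m : Q m -> (m <= \dim {:V})%N.
  by move/asboolP => [U [<- _]]; rewrite dimvS ?subvf.
case: (ex_maxnP exQ ubQ) => m /asboolP[U [dU UP]] maxm.
exists U => v; split=> [/UP //|Pv].
have : Q (\dim (<[v]> + U)).
  apply/asboolP; exists (<[v]> + U)%VS; split=> // x.
  by case/memv_addP => _ /vlineP[a ->] [u uU ->]; apply: PD => //; apply: UP.
move/maxm; rewrite -dU => le_dim.
have /eqP -> : U == (<[v]> + U)%VS by rewrite eqEdim addvSr.
by apply: (subvP (addvSl _ _)); apply: memv_line.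
Qed.

(** Makes the dimension a matrix rank, to which semicontinuity applies. *)
Lemma dimv_limg_add (K : fieldType) (W V : vectType K) (f : 'Hom(W, V))
    (U : {vspace V}) :
  \dim (limg f + U) = \rank (col_mx (f2mx f) (vs2mx U)).
Proof.
rewrite /dimv /= -addsmxE; apply/eqmx_rank.
apply/eqmxP; apply: (eqmx_trans (genmxE _)); apply: adds_eqmx => //.
have -> : limg f = mx2vs (vs2mx fullv *m f2mx f) by rewrite unlock.
apply: (eqmx_trans (genmxE _)).
by apply: (eqmx_trans (eqmxMr _ (genmxE _))); rewrite mul1mx.
Qed.

Lemma f2mxE (K : fieldType) (W V : vectType K) (f : 'Hom(W, V)) i j :
  f2mx f i j = v2r (f (r2v (delta_mx 0 i))) 0 j.
Proof.
have -> : f (r2v (delta_mx 0 i)) = r2v (v2r (r2v (delta_mx 0 i)) *m f2mx f).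
  by rewrite unlock.
by rewrite !r2vK -rowE mxE.
Qed.

(** The alternatives are injectivity and surjectivity of the induced map from [W / IW] to [V / IV].
    They mean [P = IW] and [limg f + IV = fullv]; by the dimension count [dimE], each is a lower
    bound on [\dim (limg f + IV)]. *)
Lemma max_rank_dimv (K : fieldType) (W V : vectType K) (IW : {vspace W})
    (IV : {vspace V}) (f : 'Hom(W, V)) :
  (forall w, w \in IW -> f w \in IV) ->
  ((forall w, f w \in IV -> w \in IW) \/
   (forall y, exists w, f w - y \in IV)) <->
  (minn (\dim {:W} + \dim IV - \dim IW) (\dim {:V}) <= \dim (limg f + IV))%N.
Proof.
move=> fI; pose P := (f @^-1: IV)%VS.
have sIP : (IW <= P)%VS by apply/subvP => w /fI; rewrite memv_preim.
have skP : (lker f <= P)%VS.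
  by apply/subvP => w; rewrite memv_ker -memv_preim => /eqP ->; apply: mem0v.
have fP : (f @: P)%VS = (limg f :&: IV)%VS.
  by rewrite /P -lpreim_cap_limg lpreimK ?capvSr // capvC.
have dimE : (\dim (limg f + IV) + \dim P = \dim {:W} + \dim IV)%N.
  have := limg_ker_dim f P; rewrite fP (capv_idPr skP) => <-.
  have := limg_ker_dim f fullv; rewrite capfv => <-.
  by rewrite addnCA dimv_sum_cap addnA.
have injE : (forall w, f w \in IV -> w \in IW) <->
    (\dim {:W} + \dim IV - \dim IW <= \dim (limg f + IV))%N.
  rewrite leq_subLR -dimE addnC leq_add2r (geq_leqif (dimv_leqif_sup sIP)).
  split=> [h|/subvP h w fw]; last by apply: h; rewrite -memv_preim.
  by apply/subvP => w; rewrite -memv_preim; apply: h.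
have surjE : (forall y, exists w, f w - y \in IV) <->
    (\dim {:V} <= \dim (limg f + IV))%N.
  rewrite (geq_leqif (dimv_leqif_sup (subvf _))); split=> [h|/subvP h y].
    apply/subvP => y _; have [w fwy] := h y.
    rewrite -[y](subKr (f w)); apply: memv_add; last by rewrite memvN.
    exact: memv_img (memvf w).
  have /memv_addP[_ /memv_imgP[w _ ->] [u uI yE]] := h y (memvf y).
  by exists w; rewrite yE opprD addrA subrr add0r memvN.
by rewrite geq_min injE surjE; split=> [[]->|/orP]; rewrite ?orbT.
Qed.

(** * Multiplication by powers of a varying linear form *)

Definition linear_form (C : fieldType) (N : nat) (v : 'I_N -> C) :
  {mpoly C[N]} := \sum_j v j *: 'X_j.

Lemma linear_form_homog (C : fieldType) (N : nat) (v : 'I_N -> C) :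
  linear_form v \is 1.-homog.
Proof. by apply: rpred_sum => j _; apply: rpredZ; rewrite dhomogX /= mdeg1. Qed.

Lemma linear_form_coeff (C : fieldType) (N : nat) (v : 'I_N -> C) (j : 'I_N) :
  (linear_form v)@_U_(j) = v j.
Proof.
rewrite raddf_sum /= (bigD1 j) //= mcoeffZ mcoeffX eqxx mulr1 big1 ?addr0 //.
by move=> i nij; rewrite mcoeffZ mcoeffX eq_mnm1 (negbTE nij) mulr0.
Qed.

(** Expanding one factor of the power over the coordinates and absorbing each ['X_j] into [w] lowers
    [k]. *)
Lemma polyfun_linear_form_power (C : fieldType) (N k : nat)
    (psi : {mpoly C[N]} -> C) (w : {mpoly C[N]}) :
  scalar psi -> polyfun (fun v => psi (linear_form v ^+ k * w)).
Proof.
move=> hpsi; have psi0 : psi 0 = 0.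
  by have := hpsi (- 1) 0 0; rewrite scaler0 addr0 mulN1r addNr.
have psiD u v : psi (u + v) = psi u + psi v.
  by have := hpsi 1 u v; rewrite scale1r mul1r.
have psiZ a u : psi (a *: u) = a * psi u.
  by have := hpsi a u 0; rewrite !addr0 psi0 addr0.
elim: k w => [|k IH] w.
  by apply: (polyfun_eq _ (polyfun_const _ (psi w))) => v; rewrite mul1r.
pose f v := \sum_j v j * psi (linear_form v ^+ k * ('X_j * w)).
apply: (@polyfun_eq _ _ f) => [v|]; last first.
  apply: polyfun_sum => j; apply: polyfunM; first exact: polyfun_coord.
  exact: IH.
rewrite exprSr -mulrA mulr_suml mulr_sumr (big_morph psi psiD psi0).
by apply: eq_bigr => j _; rewrite -scalerAl -scalerAr psiZ.
Qed.

Definition dhomog_proj (C : fieldType) (n e : nat) (p : {mpoly C[n.+1]}) :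
  dhomog n.+1 C e := DHomog (pihomogP mdeg e p).

Lemma dhomog_proj_is_linear (C : fieldType) (n e : nat) :
  linear (@dhomog_proj C n e).
Proof. by move=> a p q; apply: val_inj; rewrite /= linearP. Qed.

HB.instance Definition _ (C : fieldType) (n e : nat) :=
  GRing.isLinear.Build C {mpoly C[n.+1]} (dhomog n.+1 C e) _
    (@dhomog_proj C n e) (@dhomog_proj_is_linear C n e).

(** The projection makes the product a map between fixed vector spaces; when the degrees add up to
    [e] it changes nothing. *)
Definition dhomog_mul (C : fieldType) (n a e : nat) (G : {mpoly C[n.+1]})
    (w : dhomog n.+1 C a) : dhomog n.+1 C e := dhomog_proj e (G * val w).

Lemma dhomog_mul_is_linear (C : fieldType) (n a e : nat) (G : {mpoly C[n.+1]}) :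
  linear (@dhomog_mul C n a e G).
Proof.
by move=> c p q; rewrite /dhomog_mul linearP /= mulrDr -scalerAr linearP.
Qed.

HB.instance Definition _ (C : fieldType) (n a e : nat) (G : {mpoly C[n.+1]}) :=
  GRing.isLinear.Build C (dhomog n.+1 C a) (dhomog n.+1 C e) _
    (@dhomog_mul C n a e G) (@dhomog_mul_is_linear C n a e G).

Lemma ideal_vspace (C : fieldType) (n r e : nat) (F : 'I_r -> {mpoly C[n.+1]}) :
  exists U : {vspace dhomog n.+1 C e}, forall v, v \in U <-> ideal_gen F (val v).
Proof.
have [I0 ID IM] := ideal_gen_ideal F.
apply: vspace_of_closed => // a u v Iu Iv; rewrite linearP /=.
by apply: ID => //; rewrite -mul_mpolyC; apply: IM.
Qed.

(** For [k <= e], maximal rank at [v] says that a matrix with entries polynomial in [v] has at least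
    a certain rank, and this bound does not depend on [v]; rank is lower semicontinuous. *)
Lemma SLP_open (C : fieldType) (n r e k : nat) (F : 'I_r -> {mpoly C[n.+1]})
    (v0 : 'I_n.+1 -> C) :
  SLP_injective F e k (linear_form v0) \/ SLP_surjective F e k (linear_form v0) ->
  exists f, [/\ polyfun f, f v0 != 0 & forall v, f v != 0 ->
    SLP_injective F e k (linear_form v) \/ SLP_surjective F e k (linear_form v)].
Proof.
have [le_ke|lt_ek] := leqP k e; last first.
  move=> _; exists (fun=> 1); split; [exact: polyfun_const|exact: oner_neq0|].
  move=> v _; left=> f; rewrite in_degreeB leqNgt lt_ek /= => /eqP -> _.
  by case: (ideal_gen_ideal F).
have [IV IVP] := ideal_vspace e F; have [IW IWP] := ideal_vspace (e - k) F.
pose T v : 'Hom(dhomog n.+1 C (e - k), dhomog n.+1 C e) :=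
  linfun (dhomog_mul e (linear_form v ^+ k)).
have [_ _ IM] := ideal_gen_ideal F.
have valT v w : val (T v w) = linear_form v ^+ k * val w.
  have := dhomogM (power_homog k (linear_form_homog v)) (valP w).
  by rewrite subnKC // lfunE /= => /pihomog_dE ->.
have TI v w : w \in IW -> T v w \in IV.
  by move/IWP => Iw; apply/IVP; rewrite valT; apply: IM.
pose c := minn (\dim {:dhomog n.+1 C (e - k)} + \dim IV - \dim IW)
  (\dim {:dhomog n.+1 C e}).
have SLPE v : SLP_injective F e k (linear_form v) \/
    SLP_surjective F e k (linear_form v) <-> (c <= \dim (limg (T v) + IV))%N.
  rewrite -(max_rank_dimv (TI v)); split=> -[h|h]; [left|right|left|right].
  - move=> w /IVP; rewrite valT => Iw; apply/IWP; apply: h => //.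
    by rewrite in_degreeB le_ke; apply: valP.
  - move=> y; have [f hf Ify] := h (val y) (valP y).
    rewrite in_degreeB le_ke in hf; exists (DHomog hf).
    by apply/IVP; rewrite raddfB /= valT.
  - move=> f; rewrite in_degreeB le_ke => hf If.
    by apply/(IWP (DHomog hf)); apply: h; apply/IVP; rewrite valT.
  - move=> y hy; have [w /IVP] := h (DHomog hy); rewrite raddfB /= valT => Iwy.
    by exists (val w) => //; rewrite in_degreeB le_ke; apply: valP.
move/SLPE; rewrite dimv_limg_add => c_le.
have [|f [pf nf fP]] :=
    @mxrank_semicontinuous _ _ _ _ (fun v => col_mx (f2mx (T v)) (vs2mx IV)) v0.
  move=> i j; rewrite -(splitK i); case: (split i) => i' /=.
    pose psi p : C := v2r (dhomog_proj e p) 0 j.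
    have psi_lin : scalar psi by move=> a p q; rewrite /psi 2!linearP !mxE.
    apply: polyfun_eq (polyfun_linear_form_power k
      (val (r2v (delta_mx 0 i') : dhomog n.+1 C (e - k))) psi_lin) => v.
    by rewrite col_mxEu f2mxE lfunE.
  by apply: polyfun_eq (polyfun_const _ (vs2mx IV i' j)) => v; rewrite col_mxEd.
exists f; split=> // v nfv; apply/SLPE; rewrite dimv_limg_add.
exact: leq_trans c_le (fP v nfv).
Qed.

(** * Jets of univariate polynomials *)

(** In characteristic 0 differentiation lowers the order of a root by exactly one. *)
Lemma dvdp_exp_deriv (C : numFieldType) (p : {poly C}) (a : C) (m : nat) :
  p.[a] = 0 -> ('X - a%:P) ^+ m %| p^`() -> ('X - a%:P) ^+ m.+1 %| p.
Proof.
move=> pa dvd_m; have [->|nzp] := eqVneq p 0; first exact: dvdp0.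
have [j [q nqa pE]] := multiplicity_XsubC p a; rewrite nzp /= in nqa.
case: j pE => [|j] pE.
  by move: nqa; rewrite pE expr0 mulr1 in pa; rewrite /root pa eqxx.
have [le_mj|lt_jm] := leqP m j; first by rewrite pE dvdp_mull // dvdp_exp2l.
have : ('X - a%:P) ^+ j.+1 %| p^`() by apply: dvdp_trans dvd_m; apply: dvdp_exp2l.
rewrite pE derivM dvdp_addr; last exact: dvdp_mull (dvdpp _).
rewrite deriv_exp derivXsubC mul1r /= -scaler_nat -scalerAr.
rewrite dvdpZr ?pnatr_eq0 // exprS dvdp_mul2r.
  by rewrite dvdp_XsubCl (negbTE nqa).
by rewrite expf_neq0 // polyXsubC_eq0.
Qed.

Lemma dvdp_exp_derivn (C : numFieldType) (p : {poly C}) (a : C) (k : nat) :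
  ('X - a%:P) ^+ k %| p <-> forall s, (s < k)%N -> p^`(s).[a] = 0.
Proof.
elim: k p => [|k IH] p; first by rewrite dvd1p.
split=> [dvd_p|p0].
  have [q pE] := dvdpP _ _ dvd_p.
  case=> [|s] lt_sk; first by rewrite derivn0 pE hornerM exprS hornerM hornerXsubC
    subrr mul0r mulr0.
  rewrite derivSn; apply: (IH _).1 lt_sk.
  rewrite pE derivM deriv_exp derivXsubC mul1r dvdp_add //.
    by rewrite dvdp_mull // dvdp_exp2l.
  by rewrite dvdp_mull // -mulr_natl dvdp_mull.
apply: dvdp_exp_deriv; first exact: p0 0%N _.
by apply/IH => s lt_sk; rewrite -derivSn; apply: p0.
Qed.

(* Each [p^`(s)] with [s < k] gains one order of vanishing from [p^`(s.+1)], and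
   the equation passes it on to [p^`(k)]; so [p] vanishes to infinite order. *)
Lemma linear_ode_unique (C : numFieldType) (k : nat) (p de : {poly C})
    (c : 'I_k -> {poly C}) (a : C) :
  de.[a] != 0 -> de * p^`(k) = \sum_(s < k) c s * p^`(s) ->
  (forall s, (s < k)%N -> p^`(s).[a] = 0) -> p = 0.
Proof.
move=> nde ode p0.
have dvd m s : (s <= k)%N -> ('X - a%:P) ^+ m %| p^`(s).
  elim: m s => [|m IH] s; first by rewrite dvd1p.
  have lt_dvd s' : (s' < k)%N -> ('X - a%:P) ^+ m.+1 %| p^`(s').
    move=> lt_sk; apply: dvdp_exp_deriv; first exact: p0.
    by rewrite -derivnS; apply: IH.
  rewrite leq_eqVlt => /orP[/eqP ->|]; last exact: lt_dvd.
  rewrite -(@Gauss_dvdpr _ _ de).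
    rewrite ode; apply: (big_ind (fun q => _ %| q)) => [|u v|s' _].
    - exact: dvdp0.
    - exact: dvdp_add.
    - by rewrite dvdp_mull // lt_dvd.
  by rewrite coprimep_expl // coprimep_sym coprimep_XsubC.
apply/eqP; apply: contraT => nzp.
have := dvdp_leq nzp (dvd (size p) 0%N (leq0n k)).
by rewrite size_exp_XsubC ltnn.
Qed.

Definition jet (C : fieldType) (m : nat) (g : 'I_m -> {poly C}) (k : nat)
    (a : C) : 'M[C]_(k, m) := \matrix_(s, l) (g l)^`(s).[a].

(** Wronskian argument by induction on [k]. If the first [k] rows are independent at [a0] but [k.+1]
    rows are independent nowhere, every combination of the [g l] solves one linear differential
    equation of order [k]. As [k < m], some nontrivial combination has its first [k] derivatives
    zero at [a0]; it is zero by [linear_ode_unique], against independence. *)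
Lemma jet_row_free (C : numFieldType) (m k : nat) (g : 'I_m -> {poly C}) :
  (forall u : 'I_m -> C, \sum_l u l *: g l = 0 -> forall l, u l = 0) ->
  (k <= m)%N -> exists a, row_free (jet g k a).
Proof.
move=> indep; elim: k => [|k IH] lt_km.
  by exists 0; rewrite -row_leq_rank.
have [a0 fr0] := IH (ltnW lt_km); apply: contrapT => nofree.
pose G : 'M[{poly C}]_(k, m) := \matrix_(s, l) (g l)^`(s).
pose G1 : 'rV[{poly C}]_m := \row_l (g l)^`(k).
(* [B] is a constant right inverse of the jet at [a0], so the polynomial [de] has value 1 there; the
   adjugate gives the coefficients [c] by Cramer's rule. *)
pose B := pinvmx (jet g k a0); pose Bp := map_mx polyC B.
pose de := \det (G *m Bp); pose c := G1 *m Bp *m \adj (G *m Bp).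
pose ev a : {rmorphism {poly C} -> C} := horner_eval a.
have evG a : map_mx (ev a) G = jet g k a.
  by apply/matrixP => s l; rewrite !mxE.
have evB a : map_mx (ev a) Bp = B.
  by apply/matrixP => s l; rewrite !mxE /= /horner_eval hornerC.
have evde a : de.[a] = \det (jet g k a *m B).
  by rewrite -[LHS]/(ev a de) -det_map_mx map_mxM evG evB.
have nde0 : de.[a0] != 0 by rewrite evde mulmxVp // det1 oner_neq0.
have nzde : de != 0 by apply: contraNneq nde0 => ->; rewrite horner0.
have ode : de *: G1 = c *m G.
  apply/eqP; rewrite -subr_eq0; apply/eqP/matrixP => i l; rewrite ord1 [RHS]mxE.
  (* The factor [de] makes the test point [a] one where [de] is nonzero, so that the jet has
     independent rows there. *)
  apply: (mulfI nzde); rewrite mulr0; apply/eqP; apply: contraT => nz.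
  have [a] := poly_nonroot nz; rewrite hornerM mulf_eq0 negb_or => /andP[nda].
  case/negP; apply/eqP.
  have fra : row_free (jet g k a).
    have u : jet g k a *m B \in unitmx by rewrite unitmxE unitfE -evde.
    by rewrite -row_leq_rank -{1}(mxrank_unit u) mxrankM_maxl.
  have : (map_mx (ev a) G1 <= jet g k a)%MS.
    apply: contraT => nsub; case: nofree; exists a; rewrite -row_leq_rank.
    rewrite -{1}(eqP fra) rank_ltmx // ltmxE; apply/andP; split.
      apply/row_subP => s; have -> : row s (jet g k a) =
        row (widen_ord (leqnSn k) s) (jet g k.+1 a) by apply/rowP => l'; rewrite !mxE.
      exact: row_sub.
    apply: contra nsub => /(submx_trans _); apply.
    have -> : map_mx (ev a) G1 = row ord_max (jet g k.+1 a).
      by apply/rowP => l'; rewrite !mxE.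
    exact: row_sub.
  case/submxP => x xE.
  have : map_mx (ev a) (de *: G1 - c *m G) = 0.
    rewrite map_mxB map_mxZ !map_mxM map_mx_adj !map_mxM evG evB xE.
    rewrite -[ev a de]/(de.[a]) evde; set J := jet g k a.
    have -> : x *m J *m B *m \adj (J *m B) *m J =
      x *m (J *m B *m \adj (J *m B)) *m J by rewrite !mulmxA.
    by rewrite mul_mx_adj mul_mx_scalar -scalemxAl subrr.
  by move/matrixP/(_ 0 l); rewrite !mxE.
have [u nzu ku] : exists2 u : 'rV[C]_m, u != 0 & u *m (jet g k a0)^T = 0.
  exists (nz_row (kermx (jet g k a0)^T)).
    rewrite nz_row_eq0 -mxrank_eq0 mxrank_ker mxrank_tr (eqP fr0).
    by rewrite -lt0n subn_gt0.
  by apply/sub_kermxP; apply: nz_row_sub.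
pose p := \sum_l u 0 l *: g l.
have pder s : p^`(s) = \sum_l u 0 l *: (g l)^`(s).
  by rewrite raddf_sum; apply: eq_bigr => l _; rewrite /= derivnZ.
case/eqP: nzu; apply/rowP => l; rewrite mxE; apply: indep.
apply: (@linear_ode_unique _ k p de (fun s => c 0 s) a0) => //.
  rewrite pder mulr_sumr.
  rewrite (eq_bigr (fun l => u 0 l *: (\sum_s c 0 s * (g l)^`(s)))); last first.
    move=> l' _; rewrite -scalerAr; congr (_ *: _).
    have /matrixP/(_ 0 l') := ode.
    rewrite [LHS]mxE [RHS]mxE [G1 _ _]mxE => ->.
    by apply: eq_bigr => s _; rewrite [G _ _]mxE.
  rewrite (eq_bigr (fun s : 'I_k => \sum_l u 0 l *: (c 0 s * (g l)^`(s)))).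
    by rewrite exchange_big /=; apply: eq_bigr => l' _; rewrite scaler_sumr.
  by move=> s _; rewrite pder mulr_sumr; apply: eq_bigr => l' _; rewrite scalerAr.
move=> s lt_sk; have /matrixP/(_ 0 (Ordinal lt_sk)) := ku.
rewrite [LHS]mxE [RHS]mxE => ku0; rewrite pder horner_sum -[RHS]ku0.
by apply: eq_bigr => l' _; rewrite hornerZ !mxE.
Qed.

(** For [m <= k] the square matrix of the first [m] derivatives is already invertible at some [a];
    for [k < m] a right inverse of the jet interpolates the first [k] derivatives of [y]. *)
Lemma jet_maximal_rank (C : numFieldType) (m k : nat) (g : 'I_m -> {poly C}) :
  (forall u : 'I_m -> C, \sum_l u l *: g l = 0 -> forall l, u l = 0) ->
  exists a,
    (forall u : 'I_m -> C, ('X - a%:P) ^+ k %| \sum_l u l *: g l ->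
       forall l, u l = 0) \/
    (forall y, exists u : 'I_m -> C, ('X - a%:P) ^+ k %| y - \sum_l u l *: g l).
Proof.
move=> indep.
have derE (u : 'I_m -> C) s a : (\sum_l u l *: g l)^`(s).[a]
    = \sum_l u l * (g l)^`(s).[a].
  rewrite raddf_sum horner_sum; apply: eq_bigr => l _.
  by rewrite /= derivnZ hornerZ.
have [le_mk|lt_km] := leqP m k.
  have [a fr] := jet_row_free indep (leqnn m); exists a; left=> u /dvdp_exp_derivn u0.
  have uni : (jet g m a)^T \in unitmx by rewrite unitmx_tr -row_free_unit.
  have : \row_l u l *m (jet g m a)^T = 0.
    apply/rowP => s; rewrite mxE [RHS]mxE.
    rewrite -[RHS](u0 s (leq_trans (ltn_ord s) le_mk)) derE.
    by apply: eq_bigr => l _; rewrite !mxE.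
  move/(congr1 (mulmx^~ (invmx (jet g m a)^T))); rewrite mulmxK // mul0mx.
  by move=> u00 l; have := congr1 (fun A : 'rV_m => A 0 l) u00; rewrite !mxE.
have [a fr] := jet_row_free indep (ltnW lt_km); exists a; right=> y.
pose u := pinvmx (jet g k a) *m \col_s y^`(s).[a].
have uE : jet g k a *m u = \col_s y^`(s).[a] by rewrite mulmxA mulmxVp // mul1mx.
exists (fun l => u l 0); apply/dvdp_exp_derivn => s lt_sk.
rewrite derivnB hornerD hornerN derE; apply/eqP; rewrite subr_eq0; apply/eqP.
have /matrixP/(_ (Ordinal lt_sk) 0) := uE; rewrite mxE [RHS]mxE => <-.
by apply: eq_bigr => l _; rewrite mxE mulrC.
Qed.

(** * Two variables *)

Definition dehomog (C : fieldType) (f : {mpoly C[2]}) : {poly C} :=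
  mmap (@polyC C) (fun j : 'I_2 => if j == ord0 then 1 else 'X) f.

HB.instance Definition _ (C : fieldType) :=
  GRing.RMorphism.copy (@dehomog C)
    (mmap (@polyC C) (fun j : 'I_2 => if j == ord0 then 1 else 'X)).

(** Inverse of [dehomog] between polynomials of size at most [e.+1] and forms of degree [e]; higher
    coefficients are dropped. *)
Definition homogenize (C : fieldType) (e : nat) (p : {poly C}) : {mpoly C[2]} :=
  \sum_(b < e.+1) p`_b *: ('X_ord0 ^+ (e - b) * 'X_ord_max ^+ b).

Lemma homogenize_homog (C : fieldType) (e : nat) (p : {poly C}) :
  homogenize e p \is e.-homog.
Proof.
have hX j b : ('X_j : {mpoly C[2]}) ^+ b \is b.-homog.
  by apply: power_homog; rewrite dhomogX /= mdeg1.
apply: rpred_sum => b _; apply: rpredZ.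
by have := dhomogM (hX ord0 (e - b)%N) (hX ord_max b); rewrite subnK // -ltnS.
Qed.

Lemma mpolyX2 (C : fieldType) (m : 'X_{1..2}) :
  'X_[m] = 'X_ord0 ^+ m ord0 * 'X_ord_max ^+ m ord_max :> {mpoly C[2]}.
Proof.
rewrite mpolyXE_id big_ord_recr big_ord1.
by congr ('X_ _ ^+ m _ * _); apply: val_inj.
Qed.

Lemma dehomogX (C : fieldType) (j : 'I_2) :
  dehomog ('X_j : {mpoly C[2]}) = if j == ord0 then 1 else 'X.
Proof. by rewrite /dehomog mmapX mmap1U. Qed.

Lemma dehomogZ (C : fieldType) (c : C) (f : {mpoly C[2]}) :
  dehomog (c *: f) = c *: dehomog f.
Proof. by rewrite /dehomog mmapZ mul_polyC. Qed.

Lemma dehomogE (C : fieldType) (f : {mpoly C[2]}) :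
  dehomog f = \sum_(m <- msupp f) f@_m *: 'X^(m ord_max).
Proof.
rewrite {1}[f]mpolyE raddf_sum; apply: eq_bigr => m _ /=.
by rewrite dehomogZ mpolyX2 rmorphM !rmorphXn /= !dehomogX expr1n mul1r.
Qed.

Lemma homogenizeK (C : fieldType) (e : nat) (p : {poly C}) :
  (size p <= e.+1)%N -> dehomog (homogenize e p) = p.
Proof.
move=> sz; rewrite raddf_sum -[RHS](coefK p) poly_def.
rewrite (big_ord_widen e.+1 (fun b => p`_b *: 'X^b)) // [RHS]big_mkcond /=.
apply: eq_bigr => b _.
rewrite dehomogZ rmorphM !rmorphXn /= !dehomogX expr1n mul1r.
by case: ltnP => // le_pb; rewrite nth_default // scale0r.
Qed.

Lemma mdeg_ord_max (m : 'X_{1..2}) : mdeg m = (m ord0 + m ord_max)%N.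
Proof. by rewrite mdegE big_ord_recr big_ord1; congr (m _ + _)%N; apply: val_inj. Qed.

Lemma dehomogK (C : fieldType) (e : nat) (f : {mpoly C[2]}) :
  f \is e.-homog -> homogenize e (dehomog f) = f.
Proof.
move=> hf; rewrite [RHS]mpolyE dehomogE /homogenize.
rewrite (eq_bigr (fun b : 'I_e.+1 => \sum_(m <- msupp f)
   (f@_m * (b == m ord_max :> nat)%:R) *:
     ('X_ord0 ^+ (e - b) * 'X_ord_max ^+ b))); last first.
  move=> b _; rewrite coef_sum scaler_suml; apply: eq_bigr => m _.
  by rewrite coefZ coefXn.
rewrite exchange_big; apply: eq_big_seq => m /(dhomogP _ _ _ hf) /= dm.
have lt_m : (m ord_max < e.+1)%N by rewrite ltnS -dm mdeg_ord_max leq_addl.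
rewrite (bigD1 (Ordinal lt_m)) //= eqxx mulr1 big1 => [|b nb]; last first.
  by move: nb; rewrite -val_eqE /= => /negbTE ->; rewrite mulr0 scale0r.
by rewrite addr0 -dm mdeg_ord_max addnK -mpolyX2.
Qed.

Lemma size_dehomog (C : fieldType) (e : nat) (f : {mpoly C[2]}) :
  f \is e.-homog -> (size (dehomog f) <= e.+1)%N.
Proof.
move=> hf; rewrite dehomogE; apply: (leq_trans (size_sum _ _ _)).
apply/bigmax_leqP_seq => m /(dhomogP _ _ _ hf) /= dm _.
rewrite (leq_trans (size_scale_leq _ _)) //.
by rewrite size_polyXn ltnS -dm mdeg_ord_max leq_addl.
Qed.

Lemma dehomog_inj (C : fieldType) (e : nat) (f g : {mpoly C[2]}) :
  f \is e.-homog -> g \is e.-homog -> dehomog f = dehomog g -> f = g.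
Proof. by move=> hf hg fg; rewrite -(dehomogK hf) fg dehomogK. Qed.

(** [dehomog] turns [L ^+ k] into the [k]-th power of ['X - a%:P], and the jet lemma is applied to a
    basis of the ideal in degree [e]. Either the ideal has no nonzero multiple of [L ^+ k] in that
    degree, or it spans all forms of degree [e] together with these multiples. *)
Lemma SLP_bivariate (C : numFieldType) (r e k : nat)
    (F : 'I_r -> {mpoly C[2]}) :
  exists v : 'I_2 -> C,
    SLP_injective F e k (linear_form v) \/ SLP_surjective F e k (linear_form v).
Proof.
have [I0 ID IM] := ideal_gen_ideal F.
have [le_ke|lt_ek] := leqP k e; last first.
  exists (fun=> 0); left=> f; rewrite in_degreeB leqNgt lt_ek /= => /eqP -> _.
  exact: I0.
have [IV IVP] := ideal_vspace (n := 1) e F.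
pose b := vbasis IV; pose g l := dehomog (val b`_l).
have gsum u : \sum_(l < \dim IV) u l *: g l = dehomog (val (\sum_l u l *: b`_l)).
  rewrite !raddf_sum; apply: eq_bigr => l _.
  by rewrite /g -dehomogZ; congr dehomog.
have Ib u : ideal_gen F (val (\sum_(l < \dim IV) u l *: b`_l)).
  apply/IVP/memv_suml => l _; apply/memvZ/vbasis_mem/mem_nth.
  by rewrite size_tuple.
have gindep u : \sum_(l < \dim IV) u l *: g l = 0 -> forall l, u l = 0.
  rewrite gsum => e0; apply: (freeP (basis_free (vbasisP IV))).
  apply/val_inj/(dehomog_inj (valP _) (valP _)).
  by rewrite e0 /= rmorph0.
have [a h] := jet_maximal_rank k gindep.
exists (fun j => if j == ord0 then - a else 1).
set L := linear_form _; have hL : L \is 1.-homog by exact: linear_form_homog.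
have DL : dehomog L = 'X - a%:P.
  rewrite raddf_sum big_ord_recr big_ord1 /= !dehomogZ !dehomogX /=.
  by rewrite scale1r addrC scaleNr -mul_polyC mulr1.
have nzX : 'X - a%:P != 0 :> {poly C} by rewrite polyXsubC_eq0.
case: h => h; [left|right].
- move=> f hf If; have hy := in_degree_mulX hL hf.
  have yI : DHomog hy \in IV by apply/IVP.
  have yE := coord_vbasis yI; set u := fun l => coord b l (DHomog hy).
  have Dy : dehomog (L ^+ k * f) = \sum_l u l *: g l.
    by rewrite gsum -yE.
  have u0 := h u; have {}u0 : forall l, u l = 0.
    by apply: u0; rewrite -Dy rmorphM rmorphXn /= DL dvdp_mulr.
  have : dehomog (L ^+ k * f) = 0.
    by rewrite Dy big1 // => l _; rewrite u0 scale0r.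
  rewrite rmorphM rmorphXn /= DL => /eqP.
  rewrite mulf_eq0 expf_eq0 (negbTE nzX) andbF /= => /eqP Df0.
  rewrite in_degreeB le_ke in hf.
  suff -> : f = 0 by [].
  by apply: (dehomog_inj hf (dhomog0 _ _ _)); rewrite rmorph0.
- move=> y hy; have [u /dvdpP[q qE]] := h (dehomog y).
  rewrite gsum -raddfB in qE.
  set z := val _ in qE; have hyz : y - z \is e.-homog.
    by apply: rpredB => //; apply: valP.
  exists (homogenize (e - k) q); first by rewrite in_degreeB le_ke homogenize_homog.
  suff -> : L ^+ k * homogenize (e - k) q = y - z.
    by rewrite addrAC subrr add0r -mulN1r; apply/IM/Ib.
  apply: (dehomog_inj _ hyz).
    by apply: in_degree_mulX => //; rewrite in_degreeB le_ke homogenize_homog.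
  rewrite qE rmorphM rmorphXn /= DL mulrC homogenizeK //.
  (* The degree bound on [y - z] leaves [q] of degree at most [e - k], so [homogenize] drops
     nothing. *)
  have := size_dehomog hyz; rewrite qE; have [->|nzq] := eqVneq q 0.
    by rewrite size_poly0.
  rewrite size_Mmonic ?monic_exp ?monicXsubC // size_exp_XsubC addnS /=.
  by rewrite -subSn // leq_subRL 1?addnC // leqW.
Qed.

(** Finite geometric series: [G = x - y] divides [x ^+ k - y ^+ k], where [x] is a multiple of [L]
    and [y ^+ k] is a nonzero scalar times a power of ['X_j]. *)
Lemma local_inverse (C : fieldType) (N d k : nat) (L G : {mpoly C[N]})
    (j : 'I_N) (c : C) :
  (0 < k)%N -> L \is 1.-homog -> G \is d.-homog -> c != 0 ->
  principal_ideal L (G - c *: 'X_j ^+ d) ->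
  exists2 h, h \is (d * k.-1).-homog &
    principal_ideal (L ^+ k) ('X_j ^+ (d * k) - h * G).
Proof.
move=> k_gt0 hL hG nzc [q qE].
have hX : ('X_j : {mpoly C[N]}) ^+ (d * k) \is (d * k).-homog.
  by apply: power_homog; rewrite dhomogX /= mdeg1.
pose x := G - c *: 'X_j ^+ d; pose y : {mpoly C[N]} := - (c *: 'X_j ^+ d).
have yk : y ^+ k = (- c) ^+ k *: 'X_j ^+ (d * k).
  by rewrite /y -scaleNr exprZn exprM.
pose h := (- ((- c) ^+ k)^-1) *: \sum_(b < k) x ^+ (k.-1 - b) * y ^+ b.
have hE : 'X_j ^+ (d * k) - h * G = (((- c) ^+ k)^-1 *: q ^+ k) * L ^+ k.
  have -> : (((- c) ^+ k)^-1 *: q ^+ k) * L ^+ k = ((- c) ^+ k)^-1 *: x ^+ k.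
    by rewrite -scalerAl -exprMn -qE.
  have := subrXX x y k; rewrite yk (_ : x - y = G); last first.
    by rewrite /x /y opprK subrK.
  move/eqP; rewrite subr_eq => /eqP ->; rewrite scalerDr scalerA mulVf; last first.
    by rewrite expf_neq0 // oppr_eq0.
  by rewrite scale1r addrC /h -scalerAl scaleNr opprK mulrC.
have dk : (d * k = d * k.-1 + d)%N by rewrite -{1}(prednK k_gt0) mulnS addnC.
exists (pihomog mdeg (d * k.-1) h); first exact: pihomogP.
rewrite -{1}(pihomog_dE hX) -(pihomogMr _ _ hG) -dk -raddfB /= hE.
by apply: pihomog_principal => //; eexists.
Qed.

(* The section [y] is lifted to [y / F s0]; [local_inverse] inverts [F s0] modulo
   [L ^+ k] on each chart. *)
Lemma H0_Phi_surjective (C : fieldType) (N r d i k : nat)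
    (F : 'I_r -> {mpoly C[N]}) (L : {mpoly C[N]}) (s0 : 'I_r) :
  (0 < k)%N -> L \is 1.-homog -> L != 0 -> F s0 \is d.-homog ->
  ~ principal_ideal L (F s0) ->
  (forall j, exists2 c, c != 0 & principal_ideal L (F s0 - c *: 'X_j ^+ d)) ->
  sq_surjective (H0_Phi d F (J := principal_ideal (L ^+ k)) (t := i%:Z)).
Proof.
move=> k_gt0 hL nzL hG nLG hc y [y_deg y_glue].
set J := principal_ideal (L ^+ k); have hJ : is_ideal J by exact: principal_is_ideal.
have [J0 JD JM] := hJ; set G := F s0 in hG nLG hc *.
have /choice[h hh] : forall j, exists h, h \is (d * k.-1).-homog /\
    J ('X_j ^+ (d * k) - h * G).
  move=> j; have [c nzc Lc] := hc j.
  by have [h h1 h2] := local_inverse k_gt0 hL hG nzc Lc; exists h.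
pose a : carrier (sq_power r (H0 J i%:Z)) := fun s j =>
  if s == s0 then (h j * (y j).1, ((y j).2 + d * k)%N) else (0, 0%N).
exists a; split=> [s|j].
  split=> [j|j l]; rewrite /a; case: eqP => _ /=.
  - have yj : (y j).1 \is (i + d + (y j).2).-homog := y_deg j.
    have := dhomogM (hh j).1 yj.
    suff -> : (d * k.-1 + (i + d + (y j).2) = i + ((y j).2 + d * k))%N by [].
    by rewrite -{2}(prednK k_gt0) mulnS; ring.
  - by rewrite dhomog0.
  - have [e Je] := y_glue j l; exists e.
    (* Glueing is checked after multiplication by [G], a nonzerodivisor modulo [L ^+ k], which turns
       each [h j * G] into a power of ['X_j]. *)
    apply: (linear_form_power_reg hL nzL nLG).
    set f := (y j).1 in Je *; set g := (y l).1 in Je *.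
    set p := (y j).2 in Je *; set q := (y l).2 in Je *.
    set D := (d * k)%N; rewrite !(exprD _ _ D).
    have -> : G * (('X_j * 'X_l) ^+ e * ('X_l ^+ q * 'X_l ^+ D * (h j * f)
        - 'X_j ^+ p * 'X_j ^+ D * (h l * g))) =
      ('X_j * 'X_l) ^+ D * (('X_j * 'X_l) ^+ e * ('X_l ^+ q * f - 'X_j ^+ p * g))
      + ('X_j * 'X_l) ^+ e * 'X_j ^+ p * 'X_j ^+ D * g * ('X_l ^+ D - h l * G)
      - ('X_j * 'X_l) ^+ e * 'X_l ^+ q * 'X_l ^+ D * f * ('X_j ^+ D - h j * G).
      rewrite !(exprMn D); move: (_ ^+ e) ('X_j ^+ D) ('X_l ^+ D) => u v w.
      by clear Je; move: ('X_j ^+ p) ('X_l ^+ q) (h j) (h l) f g => ? ? ? ? ? ?; ring.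
    apply: (is_idealB hJ); last by apply: JM; exact: (hh _).2.
    by apply: JD; apply: JM; [exact: Je|exact: (hh _).2].
  - by exists 0%N; rewrite !mulr0 subrr mulr0.
pose g s := if s == s0 then h j * (y j).1 else 0.
have := @H0_Phi_chart _ _ _ d ((y j).2 + d * k) F J i%:Z a j g hJ.
have -> : \sum_(s < r) g s * F s = h j * (y j).1 * G.
  rewrite (bigD1 s0) //= big1 => [|s /negbTE ns]; last by rewrite /g ns mul0r.
  by rewrite /g eqxx addr0.
case: (H0_Phi d F a j) => P1 P2 /= Phi_eq; exists (d * k)%N.
have -> : 'X_j ^+ (d * k) * ('X_j ^+ (y j).2 * P1 - 'X_j ^+ P2 * (y j).1) =
  ('X_j ^+ ((y j).2 + d * k) * P1 - 'X_j ^+ P2 * (h j * (y j).1 * G))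
  - 'X_j ^+ P2 * (y j).1 * ('X_j ^+ (d * k) - h j * G).
  rewrite exprD; clear Phi_eq.
  move: (_ ^+ _) (_ ^+ P2) (_ ^+ (d * k)) (h j) (y j).1 => ? ? ? ? ?.
  by rewrite /=; ring.
apply: (is_idealB hJ); last by apply: JM; exact: (hh j).2.
apply: Phi_eq => s; rewrite /a /g; case: eqP => _; first by rewrite subrr.
by rewrite !mulr0 subrr.
Qed.

(** * General linear forms *)

Lemma zariski_open_polyfun (C : fieldType) (N : nat) (U : ('I_N -> C) -> Prop)
    (v0 : 'I_N -> C) :
  zariski_open U -> U v0 ->
  exists f, [/\ polyfun f, f v0 != 0 & forall v, f v != 0 -> U v].
Proof.
case=> E EP Uv0; have [p [Ep nzp]] : exists p, E p /\ p.@[v0] != 0.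
  apply: contrapT => np; case: ((EP v0).2 _ Uv0) => p Ep.
  by apply/eqP; apply: contraPT np => nz; case; exists p.
exists (fun v => p.@[v]); split=> // [|v nzv]; first by exists p.
apply: contrapT => nU; case/eqP: nzv; exact: (EP v).1.
Qed.

Lemma comp_mpoly_line (C : fieldType) (N d : nat) (G : {mpoly C[N]})
    (e : 'I_N -> C) (j : 'I_N) :
  G \is d.-homog ->
  G \mPo [tuple e i *: 'X_j | i < N] = G.@[e] *: 'X_j ^+ d.
Proof.
move=> hG; rewrite comp_mpolyE mevalE scaler_suml; apply: eq_big_seq => m.
move/(dhomogP _ _ _ hG) => /= <-; rewrite -scalerA; congr (_ *: _).
rewrite mdegE -prodrXr -scaler_prod; apply: eq_bigr => i _.
by rewrite tnth_mktuple exprZn.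
Qed.

Lemma mpoly1_homog (C : fieldType) (e : nat) (f : {mpoly C[1]}) :
  f \is e.-homog -> exists c, f = c *: 'X_ord0 ^+ e.
Proof.
move=> hf; exists (f.@[fun=> 1]).
rewrite -(@comp_mpoly_line _ _ _ f (fun=> 1) ord0 hf) -[LHS]comp_mpoly_id.
by congr comp_mpoly; apply: eq_mktuple => l; rewrite scale1r (ord1 l).
Qed.

(** Each degree has dimension one. A nonzero [F s] puts all of degree [i + d] into the ideal, so 0
    is a preimage of everything; if all [F s] vanish, the ideal is zero and multiplication is
    injective. *)
Lemma SLP_univariate (C : fieldType) (r d i k : nat) (F : 'I_r -> {mpoly C[1]}) :
  (forall s, F s \is d.-homog) ->
  SLP_injective F (i + d) k 'X_ord0 \/ SLP_surjective F (i + d) k 'X_ord0.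
Proof.
move=> hF; have [I0 ID IM] := ideal_gen_ideal F.
have nzX e : 'X_ord0 ^+ e != 0 :> {mpoly C[1]}.
  by rewrite expf_neq0 // -msupp_eq0 msuppX.
case: (pickP (fun s => F s != 0)) => [s nzs|F0]; [right|left].
  move=> y /mpoly1_homog[c ->]; exists 0; first exact: in_degree0.
  have [b FE] := mpoly1_homog (hF s).
  have nzb : b != 0 by apply: contraNneq nzs => b0; rewrite FE b0 scale0r.
  rewrite mulr0 sub0r -scaleNr.
  have -> : - c *: 'X_ord0 ^+ (i + d) = ((- c / b) *: 'X_ord0 ^+ i) * F s.
    by rewrite FE -scalerAl -scalerAr scalerA divfK // exprD.
  apply: IM; exists (fun s' => (s' == s)%:R).
  rewrite (bigD1 s) //= eqxx mul1r big1 ?addr0 // => s' /negbTE ->.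
  by rewrite mul0r.
move=> f _ [a]; rewrite big1 => [/eqP|s _]; last first.
  by move/negbFE/eqP: (F0 s) => ->; rewrite mulr0.
by rewrite mulf_eq0 (negbTE (nzX k)) => /eqP ->.
Qed.

(** * Every linear form against a general one *)

Lemma fails_SLP_iff (C : fieldType) (N r d i k : nat) (F : 'I_r -> {mpoly C[N]}) :
  fails_SLP (ideal_gen F) k (d%:Z + i%:Z - k%:Z) <->
  forall v, ~ (SLP_injective F (i + d) k (linear_form v) \/
               SLP_surjective F (i + d) k (linear_form v)).
Proof.
split=> [h v mr|h L hL /SLP_maximal_rank].
  exact/(h _ (linear_form_homog v))/SLP_maximal_rank.
by rewrite (linear_formE hL); apply: h.
Qed.

Lemma general_linear_formP (C : fieldType) (N : nat)
    (P : {mpoly C[N]} -> Prop) :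
  for_general_linear_form P ->
  exists f v0, [/\ polyfun f, f v0 != 0 &
    forall v, f v != 0 -> (exists j, v j != 0) -> P (linear_form v)].
Proof.
case=> U [oU [v0 Uv0] UP]; have [f [pf nf fU]] := zariski_open_polyfun oU Uv0.
exists f, v0; split=> // v nfv [j nzj]; apply: UP.
- exact: linear_form_homog.
- by apply: contraNneq nzj => L0; rewrite -(linear_form_coeff v) L0 mcoeff0.
- by under [X in U X]funext do rewrite linear_form_coeff; apply: fU.
Qed.

(** A nonzero [L] is invertible on the only chart, so any two sections are equal and the map is
    injective. *)
Lemma not_general_univariate (C : numFieldType) (r d i k : nat)
    (F : 'I_r -> {mpoly C[1]}) :
  ~ for_general_linear_form (fun L : {mpoly C[1]} =>
    ~ maximal_rank (H0_Phi d F (J := principal_ideal (L ^+ k)) (t := i%:Z))).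
Proof.
case/general_linear_formP => f [v0 [pf nf fP]].
have [v [nfv nzv]] := polyfun_avoid (w := fun=> 1) pf (polyfun_coord C ord0) nf
  (oner_neq0 C).
apply: (fP v nfv); first by exists ord0.
left=> a a' _ _ _ s j; exists k.
have -> : linear_form v = v ord0 *: 'X_ord0 by rewrite /linear_form big_ord1.
rewrite exprZn [j]ord1; set p := _ - _.
exists ((v ord0 ^+ k)^-1 *: p); rewrite -scalerAl -scalerAr scalerA.
by rewrite mulVf ?expf_neq0 // scale1r mulrC.
Qed.

(** The locus [L = 0] is the point [pt v]. If some [F s] is nonzero, then for general [v] it does
    not vanish there and both coefficients of [L] are nonzero, so [H0_Phi_surjective] applies. *)
Lemma not_general_bivariate (C : numFieldType) (r d i k : nat)
    (F : 'I_r -> {mpoly C[2]}) :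
  (0 < k)%N -> (forall s, F s \is d.-homog) ->
  (forall c, (forall s, c s \is i.-homog) ->
     \sum_(s < r) c s * F s = 0 -> forall s, c s = 0) ->
  ~ for_general_linear_form (fun L : {mpoly C[2]} =>
    ~ maximal_rank (H0_Phi d F (J := principal_ideal (L ^+ k)) (t := i%:Z))).
Proof.
move=> k_gt0 hF hK /general_linear_formP[f [v0 [pf nf fP]]].
have [v1 [nfv nv1]] := polyfun_avoid (w := fun=> 1) pf (polyfun_coord C ord0) nf
  (oner_neq0 C).
case: (pickP (fun s => F s != 0)) => [s nzs|F0]; last first.
  apply: (fP v1 nfv); first by exists ord0.
  (* If all [F s] vanish, the tuple with every entry ['X_ord0 ^+ i] is a nonzero syzygy as soon as
     an index [s] exists; so there is none and injectivity is vacuous. *)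
  left=> a a' _ _ _ s; have /eqP[] : 'X_ord0 ^+ i != 0 :> {mpoly C[2]}.
    by rewrite expf_neq0 // -msupp_eq0 msuppX.
  apply: (hK (fun=> 'X_ord0 ^+ i)) s => [s|].
    by apply: power_homog; rewrite dhomogX /= mdeg1.
  by rewrite big1 // => s _; move/negbFE/eqP: (F0 s) => ->; rewrite mulr0.
pose pt (v : 'I_2 -> C) := fun j : 'I_2 => if j == ord0 then v ord_max else - v ord0.
have ppt : polyfun (fun v => (F s).@[pt v]).
  exists (F s \mPo [tuple if j == ord0 then 'X_ord_max else - 'X_ord0 | j < 2]) => v.
  rewrite comp_mpoly_meval; apply: meval_eq => j; rewrite tnth_mktuple /pt.
  by case: eqP => _; rewrite ?mevalN mevalXU.
have [a na] : exists a, (dehomog (F s)).[a] != 0.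
  apply: poly_nonroot; apply: contraNneq nzs => D0.
  by apply/eqP/(dehomog_inj (hF s) (dhomog0 _ _ _)); rewrite D0 rmorph0.
(* The form with coefficients [- a] and 1 vanishes at the point [(1, a)], where [F s] takes the
   value of [dehomog (F s)] at [a]. *)
have npt : (F s).@[pt (fun j => if j == ord0 then - a else 1)] != 0.
  apply: contraNneq na => <-; apply/eqP.
  rewrite dehomogE horner_sum mevalE; apply: eq_bigr => m _.
  rewrite hornerZ hornerXn; congr (_ * _).
  by rewrite big_ord_recr big_ord1 /pt /= expr1n mul1r opprK.
have [v2 [nfv2 npt2]] :=
  polyfun_avoid (w := fun j => if j == ord0 then - a else 1) pf ppt nf npt.
have [v3 []] := polyfun_avoid (v := v2) (w := fun=> 1) (polyfunM pf ppt)
  (polyfunM (polyfun_coord C ord0) (polyfun_coord C ord_max))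
  (mulf_neq0 nfv2 npt2) (mulf_neq0 (oner_neq0 C) (oner_neq0 C)).
rewrite !mulf_eq0 !negb_or => /andP[nf3 npt3] /andP[n0 n1] {nfv2 npt2 v2 nfv nv1 v1}.
apply: (fP v3 nf3); first by exists ord0.
set L := linear_form v3; have hL : L \is 1.-homog by exact: linear_form_homog.
have LE : L = v3 ord0 *: 'X_ord0 + v3 ord_max *: 'X_ord_max.
  rewrite /L /linear_form big_ord_recr big_ord1.
  by congr (v3 _ *: 'X_ _ + _); apply: val_inj.
have nzL : L != 0.
  by apply: contraNneq n0 => L0; rewrite -(linear_form_coeff v3) -/L L0 mcoeff0.
have Lpt : L.@[pt v3] = 0.
  by rewrite LE mevalD !mevalZ !mevalXU /pt /= mulrN mulrC subrr.
have nLF : ~ principal_ideal L (F s).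
  case=> h /(congr1 (meval (pt v3))); rewrite mevalM Lpt mulr0 => /eqP.
  by rewrite (negbTE npt3).
right; apply: (H0_Phi_surjective (s0 := s)) => // j.
(* Modulo [L] each variable is a multiple of ['X_j], so [F s] becomes a scalar times ['X_j ^+ d];
   the scalar is nonzero since [L] does not divide [F s]. *)
pose e (l : 'I_2) := if l == j then 1 else - v3 j / v3 l.
have LF : principal_ideal L (F s - (F s).@[e] *: 'X_j ^+ d).
  rewrite -comp_mpoly_line //; apply: comp_mpoly_sub_ideal => [|l].
    exact: principal_is_ideal.
  rewrite tnth_mktuple /e; case: eqP => [->|/eqP nlj].
    by exists 0; rewrite scale1r subrr mul0r.
  have [nzl ->] : v3 l != 0 /\ L = v3 l *: 'X_l + v3 j *: 'X_j.
    have ord2 (x : 'I_2) : x = ord0 \/ x = ord_max.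
      by case: x => -[|[|]] // ?; [left|right]; apply: val_inj.
    rewrite LE; case: (ord2 l) nlj => ->; case: (ord2 j) => -> //.
    by rewrite [RHS]addrC.
  exists ((v3 l)^-1)%:MP; rewrite mul_mpolyC scalerDr !scalerA mulVf // scale1r.
  by rewrite mulNr scaleNr opprK mulrC.
exists (F s).@[e] => //; apply: contra_not_neq nLF => e0.
by move: LF; rewrite e0 scale0r subr0.
Qed.

Theorem theorem4p1 (R : realType) (n r d : nat)
    (F : 'I_r -> {mpoly R[i][n.+1]})
    (F_homog : forall s, F s \is d.-homog)
    (I_artinian : artinian_ideal (ideal_gen F))
    (i k : nat) (K_no_sections : h0_K_eq0 d F i%:Z) (k_ge1 : (1 <= k)%N) :
  fails_SLP (ideal_gen F) k (d%:Z + i%:Z - k%:Z) <->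
  for_general_linear_form (fun L : {mpoly R[i][n.+1]} =>
    ~ maximal_rank (H0_Phi d F (J := principal_ideal (L ^+ k)) (t := i%:Z))).
Proof.
have K0 c := no_syzygy (c := c) K_no_sections.
case: n F F_homog {I_artinian K_no_sections} K0 => [|[|n]] F hF K0.
- split=> [/fails_SLP_iff h|/not_general_univariate //].
  case: (h (fun=> 1)).
  rewrite /linear_form big_ord1 scale1r.
  exact: SLP_univariate.
- split=> [/fails_SLP_iff h|/(not_general_bivariate k_ge1 hF K0) //].
  by have [v hv] := SLP_bivariate (i + d) k F; case: (h v).
pose nz (v : 'I_n.+3 -> R[i]) := \prod_j v j.
have pnz : polyfun nz by apply: polyfun_prod => j; exact: polyfun_coord.
have nz1 : nz (fun=> 1) != 0 by rewrite /nz big1 ?oner_neq0.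
have nzP v : nz v != 0 -> forall j, v j != 0 by move=> /prodf_neq0 h j; apply: h.
split=> [h|/general_linear_formP[f [v0 [pf nf fP]]]].
  (* Failure holds for every form, so the open set only has to provide the nonzero coefficients
     required by [maximal_rank_iff]. *)
  exists (fun v => nz v != 0); split; last first.
  - move=> L hL nzL /nzP nzc; rewrite -(maximal_rank_iff k hF K0) //.
    exact: h.
  - by exists (fun=> 1).
  - case: pnz => p pE; exists (fun q => q = p) => v; split.
      by move/negP/negPn/eqP => nz0 _ ->; rewrite -pE.
    by move=> /(_ p erefl); rewrite -pE => ->; rewrite eqxx.
(* Maximal rank at one [v] would spread to a nonempty open set; a point [v2] common to it, to the
   given open set and to the locus of nonzero coefficients is contradictory. *)
apply/fails_SLP_iff => v /SLP_open[g [pg ng gP]].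
have [v1 [nf1 ng1]] := polyfun_avoid pf pg nf ng.
have [v2 []] := polyfun_avoid (v := v1) (polyfunM pf pg) pnz (mulf_neq0 nf1 ng1) nz1.
rewrite mulf_eq0 negb_or => /andP[nf2 ng2] /nzP nz2.
apply: (fP v2 nf2); first by exists ord0.
rewrite -(maximal_rank_iff k hF K0) ?linear_form_homog //; last first.
  by move=> l; rewrite linear_form_coeff.
exact/SLP_maximal_rank/gP.
Qed.
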